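(* Let $\hat G \subset \widehat{\mathrm{Diff}}(\mathbb{R}^1_0)$ be a solvable subgroup. Then there exists a subgroup $G \subset \mathrm{Diff}(\mathbb{R}^1_0)$ such that $T_{\underline{0}} G = \hat G$ and $T_{\underline{0}} : G \to \hat G$ is a group isomorphism.
   Context: $\mathrm{Diff}(\mathbb{R}^1_0)$ is the group (under composition) of germs at $0$ of $\mathcal{C}^\infty$ diffeomorphisms of $\mathbb{R}$ fixing $0$. $\widehat{\mathrm{Diff}}(\mathbb{R}^1_0)$ is the group of formal diffeomorphisms, i.e. formal power series $\hat f \in \mathbb{R}[[x]]$ with $\hat f(0)=0$ and $\hat f'(0) \neq 0$, under composition. $T_{\underline{0}} : \mathrm{Diff}(\mathbb{R}^1_0) \to \widehat{\mathrm{Diff}}(\mathbb{R}^1_0)$ is the group morphism sending a germ to its infinite Taylor expansion at $0$. *)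

(* Defs.v *)
From HB Require Import structures.
From mathcomp Require Import all_boot all_order all_algebra.
From mathcomp Require Import generic_quotient.
From mathcomp Require Import all_classical all_reals all_analysis.

Set Implicit Arguments.
Unset Strict Implicit.
Unset Printing Implicit Defensive.

Import Order.TTheory GRing.Theory Num.Theory.
Import numFieldNormedType.Exports.

Local Open Scope quotient_scope.
Local Open Scope ring_scope.
Local Open Scope classical_set_scope.

Section Subgroups.
Local Open Scope group_scope.

Definition is_subgroup (gT : groupType) (H : set gT) : Prop :=
  [/\ H 1, (forall x y, H x -> H y -> H (x * y)) & (forall x, H x -> H x^-1)].

Definition generated (gT : groupType) (A : set gT) : set gT :=
  [set x | forall H : set gT, is_subgroup H -> A `<=` H -> H x].

Definition derived (gT : groupType) (H : set gT) : set gT :=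
  generated [set [~ x, y] | x in H & y in H].

Definition solvable_subgroup (gT : groupType) (H : set gT) : Prop :=
  is_subgroup H /\ exists n, iter n (@derived gT) H = [set 1].

Definition restricts_to_iso (gT hT : groupType) (phi : gT -> hT)
    (G : set gT) (H : set hT) : Prop :=
  (forall x y, G x -> G y -> phi (x * y) = phi x * phi y) /\ set_bij G H phi.

End Subgroups.

Section FormalDiffeo.
Variable F : fieldType.

(* The power series \sum_n (fcoef n) x^n. *)
Record formal_diffeo := FormalDiffeo {
  fcoef :> nat -> F;
  fcoef0 : fcoef 0%N = 0;
  fcoef1 : fcoef 1%N != 0 }.

HB.instance Definition _ := gen_eqMixin formal_diffeo.
HB.instance Definition _ := gen_choiceMixin formal_diffeo.

Lemma formal_diffeoP (f g : formal_diffeo) : f =1 g -> f = g.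
Proof.
case: f g => [f f0 f1] [g g0 g1] /= /funext fg; subst g.
by congr FormalDiffeo; exact: Prop_irrelevance.
Qed.

Definition trunc (n : nat) (f : nat -> F) : {poly F} := \poly_(i < n.+1) f i.

(* As g 0 = 0, the coefficient of x^n in f(g(x)) involves only the
   coefficients of f and g of index at most n. *)
Definition fcomp (f g : nat -> F) (n : nat) : F :=
  (trunc n f \Po trunc n g)`_n.

Definition agree (n : nat) (p q : {poly F}) := forall i, (i <= n)%N -> p`_i = q`_i.

Lemma agreeM n (p p' q q' : {poly F}) :
  agree n p p' -> agree n q q' -> agree n (p * q) (p' * q').
Proof.
move=> pp qq i lei; rewrite !coefM; apply: eq_bigr => j _.
rewrite pp ?qq //; first exact: leq_trans (leq_subr _ _) lei.
by apply: leq_trans lei; rewrite -ltnS.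
Qed.

Lemma agreeX n (p p' : {poly F}) k : agree n p p' -> agree n (p ^+ k) (p' ^+ k).
Proof. by move=> pp; elim: k => // k IH; rewrite !exprS; exact: agreeM. Qed.

Lemma coefX_eq0 (q : {poly F}) k n : q`_0 = 0 -> (n < k)%N -> (q ^+ k)`_n = 0.
Proof.
move=> q0; elim: k n => // k IH n ltn; rewrite exprS coefM big1// => -[[|j] /= ltj] _.
  by rewrite q0 mul0r.
by rewrite IH ?mulr0//; case: n ltn ltj => // n ltn _; rewrite subSS (leq_ltn_trans (leq_subr _ _)).
Qed.

Lemma coefX_diag (q : {poly F}) k : q`_0 = 0 -> (q ^+ k)`_k = q`_1 ^+ k.
Proof.
move=> q0; elim: k => [|k IH]; first by rewrite !expr0 coef1.
rewrite exprS coefM big_ord_recl q0 mul0r add0r big_ord_recl /= subSS subn0 IH.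
rewrite big1 ?addr0 ?exprS// => i _; rewrite coefX_eq0 ?mulr0// /bump /=.
by rewrite !add1n subSS ltn_subrL ltn0Sn /= (leq_ltn_trans _ (ltn_ord i)).
Qed.

Lemma coef_compE (p q : {poly F}) n N : q`_0 = 0 -> (n <= N)%N ->
  (p \Po q)`_n = \sum_(i < N.+1) p`_i * (q ^+ i)`_n.
Proof.
move=> q0 leN; rewrite coef_comp_poly.
pose g i := p`_i * (q ^+ i)`_n; pose M := maxn (size p) N.+1.
rewrite (big_ord_widen M g (leq_maxl _ _)) (big_ord_widen M g (leq_maxr _ _)).
rewrite big_mkcond [RHS]big_mkcond; apply: eq_bigr => i _ /=; rewrite /g.
case: ltnP => [_|les]; case: ltnP => // ltN.
  by rewrite coefX_eq0 ?mulr0 //; exact: leq_ltn_trans leN ltN.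
by rewrite nth_default ?mul0r.
Qed.

Lemma agree_comp n (p p' q q' : {poly F}) : q`_0 = 0 ->
  agree n p p' -> agree n q q' -> agree n (p \Po q) (p' \Po q').
Proof.
move=> q0 pp qq i lei; have q'0 : q'`_0 = 0 by rewrite -qq.
rewrite !(@coef_compE _ _ i n)//; apply: eq_bigr => j _.
by rewrite (agreeX j qq)// pp// -ltnS.
Qed.

Lemma agree_trunc n m f : (n <= m)%N -> agree n (trunc m f) (trunc n f).
Proof.
by move=> lem i lei; rewrite !coef_poly !ltnS lei (leq_trans lei lem).
Qed.

Lemma coef_trunc n f i : (i <= n)%N -> (trunc n f)`_i = f i.
Proof. by move=> lei; rewrite coef_poly ltnS lei. Qed.

Lemma fcompE n m f g : g 0%N = 0 -> (n <= m)%N ->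
  fcomp f g n = (trunc m f \Po trunc m g)`_n.
Proof.
move=> g0 lem; apply: (@agree_comp n) => //; first by rewrite coef_trunc.
  by move=> i lei; rewrite (agree_trunc f lem).
by move=> i lei; rewrite (agree_trunc g lem).
Qed.

Lemma fcomp0 f g : g 0%N = 0 -> fcomp f g 0%N = f 0%N.
Proof.
move=> g0; rewrite /fcomp (@coef_compE _ _ 0 0) ?coef_trunc//.
by rewrite big_ord1 expr0 coef1 mulr1 coef_trunc.
Qed.

Lemma fcomp1 f g : g 0%N = 0 -> fcomp f g 1%N = f 1%N * g 1%N.
Proof.
move=> g0; rewrite /fcomp (@coef_compE _ _ 1 1) ?coef_trunc//.
by rewrite !big_ord_recr big_ord0 /= expr0 coef1 mulr0 !add0r expr1 !coef_trunc.
Qed.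

Lemma fcompA f g h : g 0%N = 0 -> h 0%N = 0 ->
  fcomp f (fcomp g h) = fcomp (fcomp f g) h.
Proof.
move=> g0 h0; apply/funext => n.
have gh0 : fcomp g h 0%N = 0 by rewrite fcomp0.
transitivity ((trunc n f \Po (trunc n g \Po trunc n h))`_n).
  apply: (@agree_comp n) => //; first by rewrite coef_trunc.
  by move=> i lei; rewrite coef_trunc// (fcompE _ h0 lei).
rewrite comp_polyA; apply: (@agree_comp n) => //; first by rewrite coef_trunc.
by move=> i lei; rewrite coef_trunc// (fcompE _ g0 lei).
Qed.

Definition fid (n : nat) : F := (n == 1%N)%:R.

Lemma trunc_fid n : (0 < n)%N -> trunc n fid = 'X.
Proof.
move=> n0; apply/polyP => i; rewrite coef_poly coefX /fid ltnS.
by case: ltnP => //; case: i => [|[|i]]//; rewrite ltnNge n0.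
Qed.

Lemma fcomp1f f : f 0%N = 0 -> fcomp fid f = f.
Proof.
move=> f0; apply/funext => n; rewrite (fcompE _ f0 (leqnSn n)) trunc_fid//.
by rewrite comp_polyX coef_trunc.
Qed.

Lemma fcompf1 f : fcomp f fid = f.
Proof.
apply/funext => n; rewrite (@fcompE _ n.+1)// trunc_fid//.
by rewrite comp_polyXr coef_trunc.
Qed.

(* The coefficients of the inverse g of f are the successive solutions of
   the triangular system [x^n] g(f(x)) = [x^n] x. *)
Fixpoint finv_poly (f : nat -> F) (n : nat) : {poly F} :=
  if n is m.+1 then
    let p := finv_poly f m in
    p + ((fid n - (p \Po trunc n f)`_n) / f 1%N ^+ n) *: 'X^n
  else 0.

Definition finv (f : nat -> F) (n : nat) : F := (finv_poly f n)`_n.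

Lemma size_finv_poly f n : (size (finv_poly f n) <= n.+1)%N.
Proof.
elim: n => [|n IH]; first by rewrite size_poly0.
rewrite /= (leq_trans (size_polyD _ _))// geq_max (leq_trans IH)//=.
by rewrite (leq_trans (size_scale_leq _ _))// size_polyXn.
Qed.

Lemma finv_polyE f n : finv_poly f n = trunc n (finv f).
Proof.
apply/polyP => i; rewrite coef_poly ltnS; case: leqP => [|lti]; last first.
  by rewrite nth_default// (leq_trans (size_finv_poly f n)).
elim: n => [|n IH]; first by rewrite leqn0 => /eqP->.
rewrite leq_eqVlt => /predU1P[->//|lei].
by rewrite /= coefD coefZ coefXn (ltn_eqF lei) mulr0 addr0 IH.
Qed.

Lemma finv0 f : finv f 0%N = 0.
Proof. by rewrite /finv coef0. Qed.

Lemma fcompV f : f 0%N = 0 -> f 1%N != 0 -> fcomp (finv f) f = fid.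
Proof.
move=> f0 f1; apply/funext => -[|n]; first by rewrite fcomp0 ?finv0.
rewrite /fcomp -finv_polyE /= comp_polyD coefD comp_polyZ coefZ comp_Xn_poly.
rewrite coefX_diag ?coef_trunc// -mulrA mulVf ?mulr1 ?expf_neq0//.
by rewrite addrCA subrr addr0.
Qed.

Lemma finv1_neq0 f : f 0%N = 0 -> f 1%N != 0 -> finv f 1%N != 0.
Proof.
move=> f0 f1; apply/negP => /eqP f'1.
have := fcomp1 (finv f) f0; rewrite fcompV// f'1 mul0r /fid /= => /eqP.
by rewrite oner_eq0.
Qed.

Lemma fid1_neq0 : fid 1 != 0.
Proof. by rewrite oner_neq0. Qed.

Definition formal_one := FormalDiffeo (erefl : fid 0 = 0) fid1_neq0.

Lemma formal_mul_subproof0 (f g : formal_diffeo) : fcomp f g 0%N = 0.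
Proof. by rewrite fcomp0 fcoef0. Qed.

Lemma formal_mul_subproof1 (f g : formal_diffeo) : fcomp f g 1%N != 0.
Proof. by rewrite fcomp1 ?fcoef0// mulf_neq0 ?fcoef1. Qed.

Definition formal_mul (f g : formal_diffeo) :=
  FormalDiffeo (formal_mul_subproof0 f g) (formal_mul_subproof1 f g).

Definition formal_inv (f : formal_diffeo) :=
  FormalDiffeo (finv0 f) (finv1_neq0 (fcoef0 f) (fcoef1 f)).

Lemma formal_mulA : associative formal_mul.
Proof.
by move=> f g h; apply: formal_diffeoP => n /=; rewrite fcompA ?fcoef0.
Qed.

Lemma formal_mul1 : left_id formal_one formal_mul.
Proof. by move=> f; apply: formal_diffeoP => n /=; rewrite fcomp1f ?fcoef0. Qed.

Lemma formal_mulr1 : right_id formal_one formal_mul.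
Proof. by move=> f; apply: formal_diffeoP => n /=; rewrite fcompf1. Qed.

Lemma formal_mulV : left_inverse formal_one formal_inv formal_mul.
Proof.
by move=> f; apply: formal_diffeoP => n /=; rewrite fcompV ?fcoef0 ?fcoef1.
Qed.

Lemma formal_mulrV : right_inverse formal_one formal_inv formal_mul.
Proof.
move=> f; rewrite -[LHS]formal_mul1 -{1}(formal_mulV (formal_inv f)).
rewrite -formal_mulA [X in formal_mul _ X]formal_mulA formal_mulV formal_mul1.
exact: formal_mulV.
Qed.

HB.instance Definition _ := isGroup.Build formal_diffeo
  formal_mulA formal_mul1 formal_mulr1 formal_mulV formal_mulrV.

End FormalDiffeo.

Section Smooth.
Variable R : realType.
Implicit Types f g : R -> R.

Definition smooth f : Prop := forall n x, derivable (f^`(n)) x 1.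

(* n times differentiable *)
Let diffn n f := forall k, (k < n)%N -> forall x, derivable (f^`(k)) x 1.

Lemma derive1nSr n f : f^`(n.+1) = (f^`())^`(n).
Proof. by rewrite /derive1n iterSr. Qed.

Let diffnS n f : diffn n.+1 f <-> (forall x, derivable f x 1) /\ diffn n f^`().
Proof.
split=> [df|[df df'] [|k] ltk x]; last 2 first.
- exact: df.
- by rewrite derive1nSr; exact: df'.
split; first by move=> x; exact: (df 0%N).
by move=> k ltk x; rewrite -derive1nSr; exact: df.
Qed.

Let diffnW n f : diffn n.+1 f -> diffn n f.
Proof. by move=> df k ltk; apply: df; exact: ltnW. Qed.

Let diffn0 f : diffn 0 f. Proof. by move=> k; rewrite ltn0. Qed.

Lemma derive1D_fun f g : (forall x, derivable f x 1) -> (forall x, derivable g x 1) ->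
  (f \+ g)^`() = f^`() \+ g^`().
Proof.
move=> df dg; apply/funext => x; rewrite /= 3!derive1E.
exact: (deriveD (df x) (dg x)).
Qed.

Lemma derive1M_fun f g : (forall x, derivable f x 1) -> (forall x, derivable g x 1) ->
  (f \* g)^`() = (f \* g^`()) \+ (g \* f^`()).
Proof.
move=> df dg; apply/funext => x; rewrite /= 3!derive1E.
exact: (deriveM (df x) (dg x)).
Qed.

Let diffnD n f g : diffn n f -> diffn n g -> diffn n (f \+ g).
Proof.
elim: n f g => [|n IH] f g; first by move=> _ _; exact: diffn0.
move=> /diffnS[df df'] /diffnS[dg dg']; apply/diffnS; split.
  by move=> x; exact: (derivableD (df x) (dg x)).
by rewrite (derive1D_fun df dg); exact: IH.
Qed.

Let diffnM n f g : diffn n f -> diffn n g -> diffn n (f \* g).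
Proof.
elim: n f g => [|n IH] f g; first by move=> _ _; exact: diffn0.
move=> fn gn; have /diffnS[df df'] := fn; have /diffnS[dg dg'] := gn.
apply/diffnS; split; first by move=> x; exact: (derivableM (df x) (dg x)).
rewrite (derive1M_fun df dg).
exact: diffnD (IH _ _ (diffnW fn) dg') (IH _ _ (diffnW gn) df').
Qed.

Let diffn_comp n f g : diffn n f -> diffn n g -> diffn n (f \o g).
Proof.
elim: n f g => [|n IH] f g; first by move=> _ _; exact: diffn0.
move=> fn gn; have /diffnS[df df'] := fn; have /diffnS[dg dg'] := gn.
apply/diffnS; split.
  move=> x; apply/derivable1_diffP/differentiable_comp; first exact/derivable1_diffP.
  exact/derivable1_diffP.
have -> : (f \o g)^`() = (f^`() \o g) \* g^`().
  by apply/funext => x; exact: (derive1_comp (dg x) (df (g x))).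
exact: diffnM (IH _ _ df' (diffnW gn)) dg'.
Qed.

Let smooth_diffn f : smooth f <-> forall n, diffn n f.
Proof.
split=> [sf n k _|df n]; first exact: sf.
exact: (df n.+1 n (ltnSn n)).
Qed.

Lemma smooth_derivable f x : smooth f -> derivable f x 1.
Proof. by move=> sf; exact: (sf 0%N). Qed.

Lemma smooth_derive1 f : smooth f -> smooth f^`().
Proof. by move=> sf n x; rewrite -derive1nSr; exact: sf. Qed.

Lemma smooth_continuous f : smooth f -> continuous f.
Proof.
move=> sf x; apply: differentiable_continuous; apply/derivable1_diffP.
exact: smooth_derivable.
Qed.

Lemma smoothM f g : smooth f -> smooth g -> smooth (f \* g).
Proof.
move=> /smooth_diffn sf /smooth_diffn sg; apply/smooth_diffn => n.
exact: diffnM (sf n) (sg n).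
Qed.

Lemma smooth_comp f g : smooth f -> smooth g -> smooth (f \o g).
Proof.
move=> /smooth_diffn sf /smooth_diffn sg; apply/smooth_diffn => n.
exact: diffn_comp (sf n) (sg n).
Qed.

Lemma smooth_id : smooth idfun.
Proof.
case=> [|n] x; first exact: derivable_id.
rewrite derive1nSr; have -> : (idfun : R -> R)^`() = cst 1.
  by apply/funext => y; rewrite derive1E derive_id.
case: n => [|n]; first exact: derivable_cst.
rewrite derive1nSr; have -> : (cst 1 : R -> R)^`() = cst 0.
  by apply/funext => y; rewrite derive1_cst.
suff -> : (cst 0 : R -> R)^`(n) = cst 0 by exact: derivable_cst.
elim: n => // n IH; rewrite derive1nS IH; apply/funext => y.
by rewrite derive1_cst.
Qed.

End Smooth.

Section Germs.
Variable R : realType.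

(* Representatives are diffeomorphisms of the whole line; every germ of a
   diffeomorphism defined only near 0 and fixing 0 has such a representative. *)
Record diffeo := Diffeo {
  dfun :> R -> R;
  dinv : R -> R;
  dfun_smooth : smooth dfun;
  dinv_smooth : smooth dinv;
  dfunK : cancel dfun dinv;
  dinvK : cancel dinv dfun;
  dfun0 : dfun 0 = 0 }.

HB.instance Definition _ := gen_eqMixin diffeo.
HB.instance Definition _ := gen_choiceMixin diffeo.

Definition germ_eq (f g : diffeo) : bool := `[< \forall x \near (0 : R), f x = g x >].

Lemma germ_eq_refl : reflexive germ_eq.
Proof. by move=> f; apply/asboolP; apply: filterE => x. Qed.

Lemma germ_eq_sym : symmetric germ_eq.
Proof.
have sub (f g : diffeo) : germ_eq f g -> germ_eq g f.
  move=> /asboolP fg; apply/asboolP; apply: filterS fg => x ->.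
  by [].
by move=> f g; apply/idP/idP; exact: sub.
Qed.

Lemma germ_eq_trans : transitive germ_eq.
Proof.
move=> g f h /asboolP fg /asboolP gh; apply/asboolP.
by apply: filterS2 fg gh => x -> ->.
Qed.

Canonical germ_eq_equiv :=
  EquivRel germ_eq germ_eq_refl germ_eq_sym germ_eq_trans.

Definition germ_diffeo : Type := {eq_quot germ_eq}.
HB.instance Definition _ := Choice.on germ_diffeo.
HB.instance Definition _ := EqQuotient.on germ_diffeo.

Definition diffeo_one : diffeo :=
  Diffeo (@smooth_id R) (@smooth_id R) (fun=> erefl) (fun=> erefl) erefl.

Lemma dfun_comp0 (f g : diffeo) : (f \o g) 0 = 0.
Proof. by rewrite /= !dfun0. Qed.

Definition diffeo_mul (f g : diffeo) : diffeo :=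
  Diffeo (smooth_comp (@dfun_smooth f) (@dfun_smooth g))
    (smooth_comp (@dinv_smooth g) (@dinv_smooth f))
    (can_comp (dfunK f) (dfunK g)) (can_comp (dinvK g) (dinvK f))
    (dfun_comp0 f g).

Lemma dinv0 (f : diffeo) : dinv f 0 = 0.
Proof. by rewrite -[X in dinv f X](dfun0 f) dfunK. Qed.

Definition diffeo_inv (f : diffeo) : diffeo :=
  Diffeo (@dinv_smooth f) (@dfun_smooth f) (dinvK f) (dfunK f) (dinv0 f).

Definition germ_of (f : diffeo) : germ_diffeo := \pi_germ_diffeo f.

Definition germ_one : germ_diffeo := germ_of diffeo_one.
Definition germ_mul (x y : germ_diffeo) : germ_diffeo :=
  germ_of (diffeo_mul (repr x) (repr y)).
Definition germ_inv (x : germ_diffeo) : germ_diffeo :=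
  germ_of (diffeo_inv (repr x)).

Lemma germP (f g : diffeo) :
  reflect (\forall x \near (0 : R), f x = g x) (germ_of f == germ_of g).
Proof. by apply: (iffP idP); rewrite /germ_of eqmodE => /asboolP. Qed.

Lemma germ_ind (P : germ_diffeo -> Prop) :
  (forall f, P (germ_of f)) -> forall x, P x.
Proof. by move=> Pf; elim/quotW => f; exact: Pf. Qed.

Lemma germ_repr x : germ_of (repr x) = x.
Proof. exact: reprK. Qed.

Lemma near_repr (f : diffeo) :
  \forall x \near (0 : R), repr (germ_of f) x = f x.
Proof. by apply/germP; rewrite germ_repr. Qed.

Let cvg0 (f : diffeo) : f x @[x --> 0] --> (0 : R).
Proof.
by have := smooth_continuous (@dfun_smooth f) (x := 0); rewrite /continuous_at dfun0.
Qed.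

Lemma germ_mulE (f g : diffeo) :
  germ_mul (germ_of f) (germ_of g) = germ_of (diffeo_mul f g).
Proof.
apply/eqP/germP => /=.
apply: filterS2 (near_repr g) (cvg0 g (near_repr f)) => x /= -> ->.
by [].
Qed.

Lemma germ_invE (f : diffeo) : germ_inv (germ_of f) = germ_of (diffeo_inv f).
Proof.
apply/eqP/germP => /=.
have : \forall x \near (0 : R), repr (germ_of f) (dinv f x) = x.
  have : \forall x \near (0 : R), repr (germ_of f) (dinv f x) = f (dinv f x).
    exact: (cvg0 (diffeo_inv f) (near_repr f)).
  by apply: filterS => x ->; rewrite dinvK.
apply: filterS => x {1}<-.
by rewrite dfunK.
Qed.

Lemma germ_mulA : associative germ_mul.
Proof.
elim/germ_ind => f; elim/germ_ind => g; elim/germ_ind => h.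
by rewrite !germ_mulE; apply/eqP/germP; apply: filterE => x.
Qed.

Lemma germ_mul1 : left_id germ_one germ_mul.
Proof.
by elim/germ_ind => f; rewrite germ_mulE; apply/eqP/germP; apply: filterE => x.
Qed.

Lemma germ_mulr1 : right_id germ_one germ_mul.
Proof.
by elim/germ_ind => f; rewrite germ_mulE; apply/eqP/germP; apply: filterE => x.
Qed.

Lemma germ_mulV : left_inverse germ_one germ_inv germ_mul.
Proof.
elim/germ_ind => f; rewrite germ_invE germ_mulE; apply/eqP/germP.
by apply: filterE => x /=; rewrite dfunK.
Qed.

Lemma germ_mulrV : right_inverse germ_one germ_inv germ_mul.
Proof.
elim/germ_ind => f; rewrite germ_invE germ_mulE; apply/eqP/germP.
by apply: filterE => x /=; rewrite dinvK.
Qed.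

HB.instance Definition _ := isGroup.Build germ_diffeo
  germ_mulA germ_mul1 germ_mulr1 germ_mulV germ_mulrV.

Definition taylor_coef (f : R -> R) (n : nat) : R := f^`(n)%classic 0 / n`!%:R.

Lemma taylor_coef0 (f : diffeo) : taylor_coef f 0%N = 0.
Proof. by rewrite /taylor_coef /= dfun0 mul0r. Qed.

Lemma taylor_coef1 (f : diffeo) : taylor_coef f 1%N != 0.
Proof.
rewrite /taylor_coef divr1 /=; apply/eqP => f'0.
have := derive1_comp (@smooth_derivable _ f 0 (@dfun_smooth f))
  (@smooth_derivable _ (dinv f) (f 0) (@dinv_smooth f)).
rewrite f'0 mulr0; have -> : dinv f \o f = idfun by apply/funext => x /=; rewrite dfunK.
by rewrite derive1E derive_id => /eqP; rewrite oner_eq0.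
Qed.

(* Independent of the chosen representative: see taylorE. *)
Definition taylor (x : germ_diffeo) : formal_diffeo R :=
  FormalDiffeo (taylor_coef0 (repr x)) (taylor_coef1 (repr x)).

Lemma near_taylor_coef (f g : R -> R) : (\forall x \near (0 : R), f x = g x) ->
  taylor_coef f =1 taylor_coef g.
Proof.
move=> fg n; rewrite /taylor_coef; congr (_ / _).
elim: n f g fg => [|n IH] f g fg; first exact: nbhs_singleton fg.
rewrite !derive1nSr; apply: IH.
by apply: filterS (near_join fg) => x h; rewrite !derive1E; exact: near_eq_derive.
Qed.

Lemma taylorE (f : diffeo) : taylor (germ_of f) =1 taylor_coef f.
Proof. exact: near_taylor_coef (near_repr f). Qed.

Lemma taylor_derive (f : R -> R) n :
  taylor_coef f n.+1 *+ n.+1 = taylor_coef f^`() n.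
Proof.
rewrite /taylor_coef derive1nSr factS natrM -[LHS]mulr_natr -[LHS]mulrA; congr (_ * _).
by rewrite invfM mulrAC mulVf ?mul1r// pnatr_eq0.
Qed.

Lemma trunc_taylor_derive (f : R -> R) n :
  deriv (trunc n.+1 (taylor_coef f)) = trunc n (taylor_coef f^`()).
Proof.
apply/polyP => i; rewrite coef_deriv !coef_poly ltnS.
by case: ltnP => _; rewrite ?mul0rn// taylor_derive.
Qed.

Lemma taylorD (f g : R -> R) n : smooth f -> smooth g ->
  taylor_coef (f \+ g) n = taylor_coef f n + taylor_coef g n.
Proof.
move=> sf sg; rewrite /taylor_coef -mulrDl; congr (_ / _).
elim: n f g sf sg => [|n IH] f g sf sg //.
rewrite !derive1nSr derive1D_fun; try by move=> x; exact: smooth_derivable.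
by apply: IH; exact: smooth_derive1.
Qed.

Lemma taylorM (f g : R -> R) n : smooth f -> smooth g ->
  taylor_coef (f \* g) n =
  (trunc n (taylor_coef f) * trunc n (taylor_coef g))`_n.
Proof.
elim: n f g => [|n IH] f g sf sg.
  by rewrite coef0M !coef_poly /taylor_coef !divr1.
apply: (@pmulrnI R n.+1) => //; rewrite /= taylor_derive derive1M_fun;
  try by move=> x; exact: smooth_derivable.
have sf' := smooth_derive1 sf; have sg' := smooth_derive1 sg.
have ag (p q : nat -> R) : agree n (trunc n p * trunc n q) (trunc n.+1 p * trunc n q).
  by apply: agreeM => // i lei; rewrite !coef_trunc// leqW.
rewrite (taylorD n (smoothM sf sg') (smoothM sg sf')) (IH _ _ sf sg') (IH _ _ sg sf').
rewrite (ag _ _ _ (leqnn n)) (ag (taylor_coef g) _ _ (leqnn n)).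
rewrite -!trunc_taylor_derive -coef_deriv derivM coefD addrC.
by congr (_ + _); rewrite mulrC.
Qed.

Lemma taylor_comp (f g : R -> R) n : smooth f -> smooth g -> g 0 = 0 ->
  taylor_coef (f \o g) n = fcomp (taylor_coef f) (taylor_coef g) n.
Proof.
move=> + sg g0; have tg0 : taylor_coef g 0 = 0 by rewrite /taylor_coef /= g0 mul0r.
elim/ltn_ind: n f => -[|n] IH f sf.
  by rewrite fcomp0// /taylor_coef /= g0.
apply: (@pmulrnI R n.+1) => //; rewrite /= taylor_derive.
have -> : (f \o g)^`() = (f^`() \o g) \* g^`().
  apply/funext => x; apply: derive1_comp; exact: smooth_derivable.
have sf' := smooth_derive1 sf; have sg' := smooth_derive1 sg.
rewrite (taylorM n (smooth_comp sf' sg) sg').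
rewrite /fcomp -coef_deriv deriv_comp !trunc_taylor_derive.
apply: (@agreeM _ n) (leqnn n) => [i lei|i lei]; last by [].
rewrite coef_trunc// (IH i lei _ sf') /fcomp.
apply: (@agree_comp _ i) => //; first by rewrite coef_trunc.
  by move=> j lej; rewrite !coef_trunc// (leq_trans lej).
by move=> j lej; rewrite !coef_trunc// (leq_trans lej)// leqW.
Qed.

Lemma taylor_morph : {morph taylor : x y / (x * y)%g}.
Proof.
elim/germ_ind => f; elim/germ_ind => g; apply: formal_diffeoP => n.
rewrite [(germ_of f * germ_of g)%g]germ_mulE taylorE /= /fcomp.
rewrite (taylor_comp n (@dfun_smooth f) (@dfun_smooth g) (dfun0 g)).
have tr h : trunc n (taylor (germ_of h)) = trunc n (taylor_coef h).
  by apply/polyP => i; rewrite !coef_poly; case: ifP => // _; exact: taylorE.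
by rewrite /fcomp -2!tr.
Qed.

End Germs.

(* Main.v *)
Require Import Defs.
From mathcomp Require Import all_boot all_order all_algebra.
From mathcomp Require Import all_classical all_reals all_analysis.
From mathcomp Require Import ring lra.

(** A vector field A(x) d/dx which is, up to constant factors, invariant
    under the whole group is used to select one germ above each formal series.

    If Ghat is not abelian, the last nontrivial term of its derived series is
    abelian, normal and unipotent; let alpha <> 1 belong to it. All conjugates
    of alpha under Ghat commute with alpha. The same holds if Ghat is abelian and
    contains a unipotent alpha <> 1. A formal change of coordinate turns alpha
    into the time t map of A = x^(p+1) / (1 + lam x^p), and this change of
    coordinate is realized by a smooth diffeomorphism thanks to Borel's lemma.
    Up to a constant factor, A is the only formal solution of Julia's equation
    A o alpha = alpha' A, so every f in Ghat satisfies A o f = c f' A for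
    some constant c. Outside 0, in the coordinate -1/(p x^p) + lam log x, the
    series f is an affine map, which is the expansion of the germ
    k x exp(v(x) / p) with 1 - exp(-v) = x^p (t - lam v). These germs form a
    group on which the Taylor expansion is injective.

    In the remaining case Ghat is abelian without unipotent f <> 1, and it is
    formally conjugate to a group of linear maps. *)

Set Implicit Arguments.
Unset Strict Implicit.
Unset Printing Implicit Defensive.

Import Order.TTheory GRing.Theory Num.Theory.
Import numFieldNormedType.Exports.

Local Open Scope ring_scope.
Local Open Scope classical_set_scope.

(** * Smooth functions *)

Section SmoothCalculus.
Variable R : realType.
Implicit Types (f g : R -> R) (x : R).

(** Borel's lemma lifts each series separately, but a product of two lifts agrees with the lift of
    the product only up to a flat germ. The lifts must therefore be confined to a group of germs in
    which only the identity has a trivial expansion; the exact equation in [v] leaves no room for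
    flat corrections.

    An element f of [Ghat] need not commute with alpha: it only carries alpha to another conjugate
    of alpha. As that conjugate commutes with alpha, it preserves A, and the pull-back of A by f is
    a second solution of the Julia equation of alpha. Solutions are unique up to a factor because
    the Julia operator is triangular in the order of vanishing, with a diagonal that is zero at a
    single order.

    Formal identities are handled on smooth representatives, up to flat functions, so that the chain
    rule for functions is available. As germs are represented by diffeomorphisms of the whole line,
    local formulas have to be extended by cutoffs. *)

Lemma is_derive_derive1 f f' : (forall x, is_derive x 1 f (f' x)) -> f^`() = f'.
Proof. by move=> df; apply/funext => x; rewrite derive1E; exact: derive_val. Qed.

Lemma smooth_is_derive f x : smooth f -> is_derive x 1 f (f^`() x).
Proof. by move=> sf; rewrite derive1E; apply: DeriveDef => //; exact: smooth_derivable. Qed.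

Lemma smooth_coind (P : (R -> R) -> Prop) :
  (forall f, P f -> exists2 f', P f' & forall x, is_derive x 1 f (f' x)) ->
  forall f, P f -> smooth f.
Proof.
move=> step f Pf n x.
have : P f^`(n).
  elim: n => // n IH; rewrite derive1nS.
  by have [f' Pf' /is_derive_derive1->] := step _ IH.
by move=> /step[f' _ /(_ x)[]].
Qed.

(** This serves at the origin, the only point near which [flat_exp] and the sum in Borel's lemma are
    not given by one elementary formula. The bound makes the slope function continuous there. *)
Lemma is_derive_quadratic f a C :
  (forall x, `|f x - f 0 - a * x| <= C * x ^+ 2) -> is_derive (0 : R) (1 : R) f a.
Proof.
move=> fC; apply/is_derive1_caratheodory.
exists (fun z => if z == 0 then a else (f z - f 0) / z); split; last by rewrite eqxx.
  by move=> z; rewrite subr0; case: eqVneq => [->|z0]; rewrite ?subrr ?mulr0 ?divfK.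
have C0 : 0 <= C.
  by have := le_trans (normr_ge0 _) (fC 1); rewrite expr1n mulr1.
rewrite /prop_for /continuous_at /= eqxx; apply/cvgrPdist_le => e e0.
near=> z.
case: eqVneq => [_|z0]; first by rewrite subrr normr0 ltW.
rewrite distrC -[X in _ - X](mulfK z0) -mulrBl normrM normfV ler_pdivrMr ?normr_gt0//.
apply: le_trans (fC z) _; rewrite -real_normK ?num_real// expr2 mulrA ler_wpM2r//.
apply: (@le_trans _ _ ((C + 1) * `|z|)); first by rewrite ler_wpM2r// lerDl.
rewrite mulrC -ler_pdivlMr ?ltr_pwDr//; near: z.
have d0 : 0 < e / (C + 1) by rewrite divr_gt0// ltr_pwDr.
by apply: filterS (nbhsx_ballx (0 : R) _ d0) => z; rewrite /ball /= sub0r normrN => /ltW.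
Unshelve. all: by end_near. Qed.

(* The span of these functions is stable under differentiation. *)
Definition flat_exp (k : nat) (x : R) : R :=
  if 0 < x then x^-1 ^+ k * expR (- x^-1) else 0.

(** With y = 1/x, the exponential series gives exp(y) >= y^(k+2) / (k+2)!, hence y^k exp(-y) <=
    (k+2)! / y^2. *)
Lemma flat_exp_le k x : `|flat_exp k x| <= k.+2`!%:R * x ^+ 2.
Proof.
rewrite /flat_exp; case: ifPn => [x0|_]; last by rewrite normr0 mulr_ge0// sqr_ge0.
have y0 : 0 < x^-1 by rewrite invr_gt0.
have y0W := ltW y0; rewrite ger0_norm ?mulr_ge0 ?expR_ge0 ?exprn_ge0// expRN.
rewrite ler_pdivrMr ?expR_gt0//.
have := expR_ge1Dxn k.+1 (ltW y0); set e := expR _ => he.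
have : x^-1 ^+ k.+2 / k.+2`!%:R <= e by apply: le_trans he; rewrite lerDr.
rewrite ler_pdivrMr ?ltr0n ?fact_gt0// => h.
have -> : x^-1 ^+ k = x ^+ 2 * x^-1 ^+ k.+2.
  by rewrite -(addn2 k) exprD mulrCA -exprMn mulfV ?expr1n ?mulr1// gt_eqF.
move: h; set z := x^-1 ^+ _ => h.
by rewrite [leRHS]mulrAC (mulrC _ z) ler_wpM2r ?sqr_ge0// mulrC.
Qed.

Lemma flat_exp_npos k x : x <= 0 -> flat_exp k x = 0.
Proof. by move=> x0; rewrite /flat_exp ltNge x0. Qed.

Lemma is_derive_flat_exp k x :
  is_derive x 1 (flat_exp k) (flat_exp k.+2 x - k%:R * flat_exp k.+1 x).
Proof.
have [x0|x0|->] := ltgtP x 0.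
- rewrite !flat_exp_npos ?ltW// mulr0 subr0.
  apply: (near_eq_is_derive _ (f := cst 0)).
  near=> y; rewrite flat_exp_npos// ltW//; near: y; exact: lt_nbhsl.
- have xn0 : x != 0 by rewrite gt_eqF.
  have dV : is_derive x 1 (fun y : R => y^-1) (- x^-1 ^+ 2).
    have := @is_deriveV R id x 1 1 xn0 _.
    by move=> /(_ _)/is_derive_eq; apply; rewrite scaler1 exprVn.
  have dE : is_derive x 1 (expR \o (fun y : R => - y^-1)) (expR (- x^-1) * - - x^-1 ^+ 2).
    by apply: is_derive1_comp.
  have dX := is_deriveX k dV.
  apply: (near_eq_is_derive (f := (fun y : R => y^-1) ^+ k * (expR \o (fun y : R => - y^-1)))).
    near=> y; rewrite /flat_exp ifT /= ?fctE ?exprfctE //; near: y; exact: lt_nbhsr.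
  have /is_derive_eq := is_deriveM dX dE; apply.
  rewrite /flat_exp x0 /GRing.scale /= exprfctE.
  set y := x^-1; set e := expR _.
  case: k {dX} => [|k] /=; rewrite !exprS ?expr0; ring.
- rewrite !flat_exp_npos// mulr0 subr0; apply: (@is_derive_quadratic _ _ k.+2`!%:R) => y.
  by rewrite mul0r subr0 [X in _ - X]flat_exp_npos// subr0; exact: flat_exp_le.
Unshelve. all: try by end_near.
Qed.

Lemma is_derive_add f g x a b : is_derive x 1 f a -> is_derive x 1 g b ->
  is_derive x 1 (fun y => f y + g y) (a + b).
Proof. by move=> df dg; exact: is_deriveD. Qed.

Lemma is_derive_mul f g x a b : is_derive x 1 f a -> is_derive x 1 g b ->
  is_derive x 1 (fun y => f y * g y) (a * g x + f x * b).
Proof.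
move=> df dg; have /is_derive_eq := is_deriveM df dg; apply.
by rewrite /GRing.scale /= addrC mulrC.
Qed.

Lemma is_derive_scale f x c a : is_derive x 1 f a ->
  is_derive x 1 (fun y => c * f y) (c * a).
Proof.
move=> df; have /is_derive_eq := is_derive_mul (is_derive_cst (c : R) x 1) df; apply.
by rewrite mul0r add0r.
Qed.

Lemma is_derive_sub f g x a b : is_derive x 1 f a -> is_derive x 1 g b ->
  is_derive x 1 (fun y => f y - g y) (a - b).
Proof. by move=> df dg; exact: is_deriveB. Qed.

Lemma derive1_val f x a : is_derive x 1 f a -> derive1 f x = a.
Proof. by move=> [_ <-]; rewrite derive1E. Qed.

Lemma is_derive_inv f x a : f x != 0 -> is_derive x 1 f a ->
  is_derive x 1 (fun y => (f y)^-1) (- (f x)^-1 ^+ 2 * a).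
Proof.
move=> fx df; have /is_derive_eq := is_deriveV fx df; apply.
by rewrite /GRing.scale /= exprVn.
Qed.

Lemma is_derive_comp f g x a b : is_derive (g x) 1 f a -> is_derive x 1 g b ->
  is_derive x 1 (fun y => f (g y)) (a * b).
Proof. by move=> df dg; exact: (@is_derive1_comp _ f g). Qed.

Lemma is_derive_pow n x : is_derive x 1 (fun y : R => y ^+ n) (n%:R * x ^+ n.-1).
Proof.
have -> : (fun y : R => y ^+ n) = id ^+ n by rewrite exprfctE.
have /is_derive_eq := is_deriveX n (is_derive_id x (1 : R)); apply.
by rewrite /GRing.scale /= mulr1.
Qed.

(* A class of functions stable under differentiation consists of smooth ones. *)
Inductive smooth_alg : (R -> R) -> Prop :=
| smooth_alg_base f : smooth f -> smooth_alg f
| smooth_alg_cst c : smooth_alg (fun=> c)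
| smooth_alg_expR : smooth_alg expR
| smooth_alg_flat k : smooth_alg (flat_exp k)
| smooth_alg_add f g : smooth_alg f -> smooth_alg g -> smooth_alg (fun x => f x + g x)
| smooth_alg_mul f g : smooth_alg f -> smooth_alg g -> smooth_alg (fun x => f x * g x)
| smooth_alg_inv f : smooth_alg f -> (forall x, f x != 0) -> smooth_alg (fun x => (f x)^-1)
| smooth_alg_comp f g : smooth_alg f -> smooth_alg g -> smooth_alg (fun x => f (g x))
| smooth_alg_can f g : smooth f -> (forall x, f^`() x != 0) ->
    cancel f g -> cancel g f -> smooth_alg g.

Lemma is_derive_can f g x : smooth f -> (forall x, f^`() x != 0) ->
    cancel f g -> cancel g f -> is_derive x 1 g (derive1 f (g x))^-1.
Proof.
move=> sf f'0 fK gK; rewrite -{1}(gK x); apply: is_derive_inverse.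
- by apply: filterE.
- by apply: filterE; exact: smooth_continuous.
- exact: smooth_is_derive.
- exact: f'0.
Qed.

Lemma smooth_algP f : smooth_alg f -> smooth f.
Proof.
apply: smooth_coind => {}f; elim=> {f}.
- move=> f sf; exists f^`(); first exact/smooth_alg_base/smooth_derive1.
  by move=> x; exact: smooth_is_derive.
- move=> c; exists (fun=> 0); first exact: smooth_alg_cst.
  by move=> x; exact: is_derive_cst.
- by exists expR; [exact: smooth_alg_expR|move=> x; exact: is_derive_expR].
- move=> k; exists (fun x => flat_exp k.+2 x + (- k%:R) * flat_exp k.+1 x).
    apply: smooth_alg_add (smooth_alg_mul _ _); try exact: smooth_alg_flat.
    exact: smooth_alg_cst.
  by move=> x; have /is_derive_eq := is_derive_flat_exp k x; apply; rewrite mulNr.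
- move=> f g sf [f' sf' df] sg [g' sg' dg]; exists (fun x => f' x + g' x).
    exact: smooth_alg_add.
  by move=> x; exact: is_derive_add.
- move=> f g sf [f' sf' df] sg [g' sg' dg]; exists (fun x => f' x * g x + f x * g' x).
    by apply: smooth_alg_add; exact: smooth_alg_mul.
  by move=> x; exact: is_derive_mul.
- move=> f sf [f' sf' df] f0; have sV := smooth_alg_inv sf f0.
  exists (fun x => -1 * ((f x)^-1 * (f x)^-1) * f' x).
    by do 2?apply: smooth_alg_mul => //; [exact: smooth_alg_cst|exact: smooth_alg_mul].
  by move=> x; have /is_derive_eq := is_derive_inv (f0 x) (df x); apply; rewrite expr2 mulN1r.
- move=> f g sf [f' sf' df] sg [g' sg' dg]; exists (fun x => f' (g x) * g' x).
    by apply: smooth_alg_mul => //; exact: smooth_alg_comp.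
  by move=> x; exact: is_derive_comp.
(* The derivative 1 / f'(g) of an inverse function again involves g, which the induction allows
   because the class contains g and is closed under composition and reciprocals. *)
- move=> f g sf f'0 fK gK; exists (fun x => (derive1 f (g x))^-1).
    apply: smooth_alg_inv => //; apply: smooth_alg_comp.
      exact/smooth_alg_base/smooth_derive1.
    exact: smooth_alg_can fK gK.
  by move=> x; exact: is_derive_can.
Qed.

Lemma smooth_cst (c : R) : smooth (fun=> c).
Proof. exact/smooth_algP/smooth_alg_cst. Qed.

Lemma smooth_expR f : smooth f -> smooth (fun x => expR (f x)).
Proof.
by move=> sf; apply: smooth_algP; apply: smooth_alg_comp;
  [exact: smooth_alg_expR|exact: smooth_alg_base].
Qed.

Lemma smooth_add f g : smooth f -> smooth g -> smooth (fun x => f x + g x).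
Proof.
by move=> sf sg; apply: smooth_algP; apply: smooth_alg_add; exact: smooth_alg_base.
Qed.

Lemma smooth_mul f g : smooth f -> smooth g -> smooth (fun x => f x * g x).
Proof. exact: smoothM. Qed.

Lemma smooth_opp f : smooth f -> smooth (fun x => - f x).
Proof.
move=> sf; have -> : (fun x => - f x) = (fun x => -1 * f x).
  by apply/funext => x; rewrite mulN1r.
by apply: smooth_mul sf; exact: smooth_cst.
Qed.

Lemma smooth_sub f g : smooth f -> smooth g -> smooth (fun x => f x - g x).
Proof. by move=> sf sg; apply: smooth_add sf _; exact: smooth_opp. Qed.

Lemma smooth_inv f : smooth f -> (forall x, f x != 0) -> smooth (fun x => (f x)^-1).
Proof.
by move=> sf f0; apply: smooth_algP; apply: smooth_alg_inv => //; exact: smooth_alg_base.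
Qed.

Lemma smooth_pow f n : smooth f -> smooth (fun x => f x ^+ n).
Proof.
move=> sf; elim: n => [|n IH]; first exact: smooth_cst.
have -> : (fun x => f x ^+ n.+1) = (fun x => f x * f x ^+ n).
  by apply/funext => x; rewrite exprS.
exact: smooth_mul.
Qed.

Lemma smooth_comp_fun f g : smooth f -> smooth g -> smooth (fun x => f (g x)).
Proof. exact: smooth_comp. Qed.

Lemma smooth_var : smooth (fun x : R => x).
Proof. exact: smooth_id. Qed.

End SmoothCalculus.

(** Reciprocals need a nonvanishing condition and compositions an explicit inner function; such
    goals are left to the caller. *)
Ltac smoothness :=
  lazymatch goal with
  | H : smooth ?f |- smooth ?f => exact: H
  | |- smooth (fun=> ?c) => exact: smooth_cst
  | |- smooth (fun x => x) => exact: smooth_var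
  | |- smooth (fun x => @?f x + @?g x) => apply: (@smooth_add _ f g); smoothness
  | |- smooth (fun x => - @?f x) => apply: (@smooth_opp _ f); smoothness
  | |- smooth (fun x => @?f x * @?g x) => apply: (@smooth_mul _ f g); smoothness
  | |- smooth (fun x => @?f x ^+ ?n) => apply: (@smooth_pow _ f n); smoothness
  | |- smooth (fun x => expR (@?f x)) => apply: (@smooth_expR _ f); smoothness
  | |- _ => idtac
  end.

(** * Cutoffs and the extension of local diffeomorphisms to the line *)

Section Cutoff.
Variable R : realType.
Implicit Types (f g : R -> R) (x : R).

(** The numerator vanishes for |x| >= 1 and the other summand for |x| <= 1/2, never both. Squares
    replace |x|, which is not smooth; hence the constant 1/4. *)
Definition plateau (x : R) : R :=
  flat_exp 0 (1 - x ^+ 2) / (flat_exp 0 (1 - x ^+ 2) + flat_exp 0 (x ^+ 2 - 4^-1)).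

Lemma flat_exp_ge0 x : 0 <= flat_exp 0 x.
Proof. by rewrite /flat_exp; case: ifP; rewrite ?expr0 ?mul1r ?expR_ge0. Qed.

Lemma flat_exp_gt0 x : 0 < x -> 0 < flat_exp 0 x.
Proof. by rewrite /flat_exp => ->; rewrite expr0 mul1r expR_gt0. Qed.

Lemma plateau_den_gt0 x : 0 < flat_exp 0 (1 - x ^+ 2) + flat_exp 0 (x ^+ 2 - 4^-1).
Proof.
have [x1|x1] := ltP (x ^+ 2) 1.
  by rewrite ltr_pwDl ?flat_exp_ge0// flat_exp_gt0// subr_gt0.
rewrite ltr_wpDl ?flat_exp_ge0// flat_exp_gt0// subr_gt0.
by apply: lt_le_trans x1; rewrite invf_lt1 ?ltr1n.
Qed.

Lemma smooth_flat_exp k f : smooth f -> smooth (fun x => flat_exp k (f x)).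
Proof.
by move=> sf; apply: smooth_algP; apply: smooth_alg_comp;
  [exact: smooth_alg_flat|exact: smooth_alg_base].
Qed.

Lemma smooth_plateau : smooth plateau.
Proof.
have sq : smooth (fun x : R => x ^+ 2) by apply: smooth_pow; exact: smooth_var.
have s1 := @smooth_flat_exp 0%N _ (smooth_sub (@smooth_cst R 1) sq).
have s2 := @smooth_flat_exp 0%N _ (smooth_sub sq (@smooth_cst R 4^-1)).
apply: smooth_mul s1 (smooth_inv (smooth_add s1 s2) _) => x.
by rewrite gt_eqF// plateau_den_gt0.
Qed.

Lemma plateau_ge0 x : 0 <= plateau x.
Proof. by rewrite divr_ge0 ?flat_exp_ge0// ltW ?plateau_den_gt0. Qed.

Lemma plateau_le1 x : plateau x <= 1.
Proof. by rewrite ler_pdivrMr ?plateau_den_gt0// mul1r lerDl flat_exp_ge0. Qed.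

Lemma plateau_eq1 x : `|x| <= 2^-1 -> plateau x = 1.
Proof.
move=> x2; rewrite /plateau (@flat_exp_npos _ _ (x ^+ 2 - 4^-1)) ?addr0 ?divff//.
  rewrite gt_eqF// flat_exp_gt0// subr_gt0 -real_normK ?num_real//.
  by rewrite expr_lt1// (le_lt_trans x2)// invf_lt1 ?ltr1n.
rewrite subr_le0 -real_normK ?num_real//.
have -> : 4^-1 = 2^-1 ^+ 2 :> R by rewrite expr2 -invfM -natrM.
by rewrite lerXn2r ?nnegrE.
Qed.

Lemma plateau_eq0 x : 1 <= `|x| -> plateau x = 0.
Proof.
move=> x1; rewrite /plateau flat_exp_npos ?mul0r// subr_le0 -real_normK ?num_real//.
by rewrite exprn_ege1.
Qed.

Lemma bounded_supp f : continuous f -> (forall x, 1 < `|x| -> f x = 0) ->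
  exists2 B : R, 0 <= B & forall x, `|f x| <= B.
Proof.
move=> cf f0.
have cn : continuous (fun x => `|f x|).
  by move=> x; apply: continuous_comp; [exact: cf|exact: norm_continuous].
have [c _ cmax] := @EVT_max R (fun x => `|f x|) (-1) 1 (ltac:(lra)) (continuous_subspaceT cn).
exists `|f c| => // x; have [x1|x1] := ltP 1 `|x|; first by rewrite f0// normr0.
by apply: cmax; rewrite in_itv /= -ler_norml.
Qed.

(* Composing f with [cutoff e] only involves f on [-e, e], so that a bound on
   f' near 0 suffices to control the derivative of the extension of f. *)
Definition cutoff (e x : R) : R := x * plateau (x / e).

Lemma smooth_cutoff e : smooth (cutoff e).
Proof.
rewrite /cutoff; have sb : smooth (fun x => plateau (x / e)).
  by apply: (smooth_comp_fun smooth_plateau); smoothness.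
smoothness.
Qed.

Lemma plateau_near e : 0 < e -> \forall x \near (0 : R), plateau (x / e) = 1.
Proof.
move=> e0; have e20 : 0 < e / 2 by lra.
apply: filterS (nbhsx_ballx (0 : R) _ e20) => x; rewrite /ball /= sub0r normrN => xe.
rewrite plateau_eq1// normrM normfV (gtr0_norm e0) ler_pdivrMr//.
by rewrite mulrC ltW.
Qed.

Lemma cutoff_id e : 0 < e -> \forall x \near (0 : R), cutoff e x = x.
Proof. by move=> /plateau_near; apply: filterS => x xe; rewrite /cutoff xe mulr1. Qed.

Lemma cutoff0 e : cutoff e 0 = 0.
Proof. by rewrite /cutoff mul0r. Qed.

Lemma cutoff_le e x : 0 < e -> `|cutoff e x| <= e.
Proof.
move=> e0; rewrite /cutoff normrM (ger0_norm (plateau_ge0 _)).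
have [xe|xe] := leP `|x| e.
  by apply: le_trans xe; rewrite ler_piMr// plateau_le1.
rewrite plateau_eq0 ?mulr0 ?ltW// normrM normfV (gtr0_norm e0) ltr_pdivlMr//.
by rewrite mul1r.
Qed.

Lemma derive1_supp f r : (forall x, r < `|x| -> f x = 0) ->
  forall x, r < `|x| -> derive1 f x = 0.
Proof.
move=> f0 x rx; apply: derive1_val.
apply: (near_eq_is_derive (f := cst 0)).
have : \forall y \near x, r < `|y| by exact: (@norm_continuous _ R x _ (lt_nbhsr rx)).
by apply: filterS => y /f0 ->.
Qed.

(** By scaling, the derivative of [cutoff e] at x is h(x/e) for a fixed compactly supported h, so
    one bound holds for every e. *)
Lemma derive1_cutoff_le : exists2 C : R, 0 < C & forall e x, 0 < e -> `|derive1 (cutoff e) x| <= C.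
Proof.
have sb' := smooth_derive1 smooth_plateau.
pose h x := plateau x + x * derive1 plateau x.
have sh : smooth h by have sb := smooth_plateau; rewrite /h; smoothness.
have h0 x : 1 < `|x| -> h x = 0.
  move=> x1; rewrite /h plateau_eq0 ?ltW// add0r.
  by rewrite (@derive1_supp _ 1) ?mulr0// => y y1; rewrite plateau_eq0// ltW.
have [B B0 hB] := bounded_supp (smooth_continuous sh) h0.
exists (B + 1) => [|e x e0]; first lra.
suff -> : derive1 (cutoff e) x = h (x / e) by have := hB (x / e); lra.
have d1 : is_derive x 1 (fun y : R => y / e) (1 / e).
  have /is_derive_eq := is_derive_mul (is_derive_id x 1) (is_derive_cst e^-1 x 1); apply.
  by rewrite mulr0 addr0.
have d2 := is_derive_comp (g := fun y => y / e) (smooth_is_derive (x / e) smooth_plateau) d1.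
by rewrite (derive1_val (is_derive_mul (is_derive_id x 1) d2)) /h; ring.
Qed.

Definition diffeo_of_bij f g (sf : smooth f) (f'0 : forall x, derive1 f x != 0)
    (fK : cancel f g) (gK : cancel g f) (f0 : f 0 = 0) : diffeo R :=
  Diffeo sf (smooth_algP (smooth_alg_can sf f'0 fK gK)) fK gK f0.

Lemma MVT_ge f c x y : smooth f -> (forall z, c <= derive1 f z) -> x <= y ->
  c * (y - x) <= f y - f x.
Proof.
move=> sf f'c xy.
have [|z _ ->] := @MVT_segment R f (derive1 f) x y xy _ (continuous_subspaceT (smooth_continuous sf)).
  by move=> z _; exact: smooth_is_derive.
by rewrite ler_wpM2r ?f'c// subr_ge0.
Qed.

Lemma derive_ge_bij f c : smooth f -> f 0 = 0 -> 0 < c -> (forall x, c <= derive1 f x) ->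
  exists g, cancel f g /\ cancel g f.
Proof.
move=> sf f0 c0 f'c.
have mono := MVT_ge sf f'c.
have inj x y : f x = f y -> x = y.
  wlog xy : x y / x <= y.
    by move=> H fxy; case: (leP x y) => [/H->//|/ltW/H ->].
  move=> fxy; apply/eqP; rewrite eq_le xy /= -subr_le0 -(pmulr_rle0 _ c0).
  by rewrite (le_trans (mono _ _ xy))// fxy subrr.
have surj v : exists x, f x = v.
  (* As the slope is at least c, the values of f at -|v|/c and |v|/c enclose v. *)
  have ab : - (`|v| / c) <= `|v| / c.
    by rewrite ge0_cp// divr_ge0// ltW.
  have := mono _ _ ab.
  have hb : 0 <= `|v| / c by rewrite divr_ge0// ltW.
  have := mono 0 _ hb; have := mono (- (`|v| / c)) 0; rewrite oppr_le0 => /(_ hb).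
  rewrite f0 !subr0 !sub0r opprK mulrC divfK ?gt_eqF// => h1 h2 _.
  have [|x _ fx] := @IVT R f _ _ v ab (continuous_subspaceT (smooth_continuous sf)); last by exists x.
  have := ler_norm v; have := ler_norm (- v); rewrite normrN => v1 v2.
  by rewrite ge_min le_max; apply/andP; split; apply/orP; [left|right]; lra.
have [g gK] := choice surj.
by exists g; split=> // x; apply: inj; rewrite gK.
Qed.

Theorem diffeo_extension f : smooth f -> f 0 = 0 -> derive1 f 0 != 0 ->
  exists d : diffeo R, \forall x \near (0 : R), d x = f x.
Proof.
move=> sf f0; set a : R := derive1 f 0 => a0.
have [C C0 hC] := derive1_cutoff_le.
(* If f' varies by at most |a| / (2C) on the range of the cutoff, the slope of [G] below stays
   within 1/2 of 1. *)
have aC0 : 0 < `|a| / (2 * C) by rewrite divr_gt0 ?normr_gt0 ?mulr_gt0.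
have := smooth_continuous (smooth_derive1 sf) (x := 0).
move=> /cvgrPdist_le/(_ _ aC0)/nbhs_ballP[d /= d0 hd].
have e0 : 0 < d / 2 by rewrite divr_gt0.
set e := d / 2 in e0.
have f'e y : `|y| <= e -> `|a - derive1 f y| <= `|a| / (2 * C).
  move=> ye; apply: hd; rewrite /ball /= sub0r normrN (le_lt_trans ye)//.
  by rewrite /e ltr_pdivrMr// ltr_pMr// ltr1n.
(* [G] is f / a near 0 and the identity far away; dividing by a makes its slope positive whatever
   the sign of a. *)
pose G x := a^-1 * (f (cutoff e x) + a * (x - cutoff e x)).
have sG : smooth G.
  have sc := @smooth_cutoff e; have := smooth_comp_fun sf sc.
  by rewrite /G => sfc; smoothness.
have G0 : G 0 = 0 by rewrite /G cutoff0 f0 subrr mulr0 addr0 mulr0.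
have G'E x : derive1 G x = 1 - a^-1 * ((a - derive1 f (cutoff e x)) * derive1 (cutoff e) x).
  have dc := smooth_is_derive x (@smooth_cutoff e).
  have d1 := is_derive_comp (smooth_is_derive _ sf) dc.
  have d2 := is_derive_scale a (is_derive_sub (is_derive_id x (1 : R)) dc).
  rewrite (derive1_val (is_derive_scale a^-1 (is_derive_add d1 d2))).
  by field.
have G'ge x : 2^-1 <= derive1 G x.
  rewrite G'E; suff : `|a^-1 * ((a - derive1 f (cutoff e x)) * derive1 (cutoff e) x)| <= 2^-1.
    by rewrite ler_norml => /andP[_]; lra.
  rewrite normrM normfV mulrC ler_pdivrMr ?normr_gt0// normrM.
  apply: (@le_trans _ _ (`|a| / (2 * C) * C)).
    by apply: ler_pM => //; [exact/f'e/cutoff_le|exact: hC].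
  by rewrite invfM mulrA divfK ?gt_eqF// mulrC.
have [H [GK HK]] := derive_ge_bij sG G0 (ltac:(lra) : 0 < 2^-1 :> R) G'ge.
pose F x := a * G x.
have sF : smooth F by rewrite /F; smoothness.
have F'0 x : derive1 F x != 0.
  rewrite (derive1_val (is_derive_scale a (smooth_is_derive x sG))).
  by rewrite mulf_neq0// gt_eqF// (lt_le_trans _ (G'ge x)).
have FK : cancel F (fun y => H (a^-1 * y)) by move=> x; rewrite /F mulKf// GK.
have KF : cancel (fun y => H (a^-1 * y)) F by move=> x; rewrite /F HK mulVKf.
have F0 : F 0 = 0 by rewrite /F G0 mulr0.
exists (diffeo_of_bij sF F'0 FK KF F0).
apply: filterS (cutoff_id e0) => x xe.
by rewrite /= /F /G xe subrr mulr0 addr0 mulVKf.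
Qed.

Lemma is_derive_sum_ord M (F : nat -> R -> R) (F' : nat -> R) x :
  (forall n, is_derive x 1 (F n) (F' n)) ->
  is_derive x 1 (fun y => \sum_(n < M) F n y) (\sum_(n < M) F' n).
Proof.
move=> dF; elim: M => [|M IH].
  rewrite big_ord0; under eq_fun do rewrite big_ord0; exact: is_derive_cst.
rewrite big_ord_recr /=; under eq_fun do rewrite big_ord_recr /=.
exact: is_derive_add.
Qed.

Lemma taylor_horner (p : {poly R}) n : taylor_coef (fun x => p.[x]) n = p`_n.
Proof.
elim: n p => [|n IH] p; first by rewrite /taylor_coef /= divr1 horner_coef0.
apply: (@pmulrnI R n.+1) => //; rewrite /= taylor_derive -coef_deriv -IH.
by congr taylor_coef; apply: is_derive_derive1 => x; exact: is_derive_poly.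
Qed.

End Cutoff.

(** * Borel's lemma *)

Section Borel.
Variable R : realType.
Implicit Types (x e : R).

Let v e n x : R := x ^+ n * plateau (x / e).

Let smooth_v e n : smooth (v e n).
Proof.
rewrite /v; have s : smooth (fun x => plateau (x / e)).
  by apply: (smooth_comp_fun (@smooth_plateau R)); smoothness.
smoothness.
Qed.

(* phi does not depend on e: differentiating x^m phi(x/e) gives
   x^(m-1) (m phi + y phi'(y)) at y = x/e. *)
Let derive1n_v n j : (j <= n)%N -> exists phi : R -> R,
  [/\ smooth phi, forall x, 1 < `|x| -> phi x = 0
    & forall e x, 0 < e -> derive1n j (v e n) x = x ^+ (n - j) * phi (x / e)].
Proof.
elim: j => [_|j IH ltjn].
  exists (@plateau R); split; first exact: smooth_plateau.
    by move=> x x1; rewrite plateau_eq0// ltW.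
  by move=> e x _; rewrite subn0.
have [phi [sp p0 vE]] := IH (ltnW ltjn).
exists (fun y => (n - j)%:R * phi y + y * derive1 phi y); split.
- have sp' := smooth_derive1 sp; smoothness.
- by move=> x x1; rewrite p0// (derive1_supp p0)// !mulr0 addr0.
move=> e x e0; rewrite derive1nS.
rewrite (_ : derive1n j (v e n) = fun x => x ^+ (n - j) * phi (x / e)); last first.
  by apply/funext => y; exact: vE.
have d0 := is_derive_mul (is_derive_id x (1 : R)) (is_derive_cst (e^-1 : R) x 1).
have d1 := is_derive_comp (g := fun y => y / e) (smooth_is_derive _ sp) d0.
rewrite (derive1_val (is_derive_mul (is_derive_pow (n - j) x) d1)).
rewrite subnS; case: (n - j)%N (subn_gt0 j n) => [|m _]; first by rewrite ltjn.
rewrite /= exprS; ring.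
Qed.

(** On the support |x| <= e <= 1, and at least three factors x remain after j <= n - 3 derivatives:
    one is bounded by e, two give x^2, the others are at most 1. *)
Let v_bound n : exists2 B : R, 0 <= B & forall j e x, (j + 3 <= n)%N -> 0 < e <= 1 ->
  `|derive1n j (v e n) x| <= B * e * x ^+ 2.
Proof.
suff /choice[B hB] : forall j, exists B : R, 0 <= B /\
    ((j + 3 <= n)%N -> forall e x, 0 < e <= 1 -> `|derive1n j (v e n) x| <= B * e * x ^+ 2).
  (* The bound must not depend on j; only the finitely many j < n matter, so their constants are
     added. *)
  exists (\sum_(j < n) B j) => [|j e x lej e01].
    by apply: sumr_ge0 => j _; case: (hB j).
  have ltjn : (j < n)%N by apply: leq_trans lej; rewrite -addn1 leq_add2l.
  have [_ /(_ lej e x e01) /le_trans->//] := hB j.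
  rewrite ler_wpM2r ?sqr_ge0// ler_wpM2r//; first by case/andP: e01 => /ltW.
  rewrite (bigD1 (Ordinal ltjn))//= lerDl.
  by apply: sumr_ge0 => i _; case: (hB i).
move=> j; have [lej|_] := leqP (j + 3) n; last by exists 0.
have lejn : (j <= n)%N by apply: leq_trans lej; rewrite leq_addr.
have [phi [sp p0 vE]] := derive1n_v lejn.
have [B B0 hB] := bounded_supp (smooth_continuous sp) p0.
exists B; split=> // _ e x /andP[e0 e1]; rewrite vE// normrM.
have [xe|xe] := leP `|x| e; last first.
  have h0 : 0 <= B * e * x ^+ 2 by rewrite mulr_ge0 ?sqr_ge0// mulr_ge0// ltW.
  rewrite p0 ?normr0 ?mulr0//.
  by rewrite normrM normfV (gtr0_norm e0) ltr_pdivlMr// mul1r.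
rewrite mulrC -mulrA; apply: ler_pM => //.
have -> : (n - j = (n - j - 3).+3)%N by rewrite -addn3 subnK// leq_subRL.
rewrite normrX exprSr exprSr exprSr.
rewrite -[x ^+ 2]real_normK ?num_real// -mulrA -mulrA mulrCA.
rewrite ler_pM ?mulr_ge0// -[leRHS]mul1r ler_wpM2r ?mulr_ge0 ?exprn_ge0//.
by rewrite exprn_ile1// (le_trans xe).
Qed.

Let term (c : nat -> R) (eps : nat -> R) n j x := c n * derive1n j (v (eps n) n) x.

Let choose_eps (c : nat -> R) : exists eps : nat -> R, forall n,
  [/\ 0 < eps n, eps n <= n.+1%:R^-1
    & forall j x, (j + 3 <= n)%N -> `|term c eps n j x| <= 2^-1 ^+ n * x ^+ 2].
Proof.
suff /choice[eps h] : forall n, exists e, [/\ 0 < e, e <= n.+1%:R^-1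
    & forall j x, (j + 3 <= n)%N -> `|c n * derive1n j (v e n) x| <= 2^-1 ^+ n * x ^+ 2].
  by exists eps.
move=> n; have [B B0 hB] := v_bound n.
have D0 : 0 < `|c n| * B + 1 by rewrite ltr_wpDl// mulr_ge0.
have h0 : 0 < (2^-1 : R) ^+ n by rewrite exprn_gt0.
exists (Num.min n.+1%:R^-1 (2^-1 ^+ n / (`|c n| * B + 1))).
set e := Num.min _ _.
have e0 : 0 < e by rewrite lt_min invr_gt0 ltr0n /= divr_gt0.
have en : e <= n.+1%:R^-1 by rewrite ge_min lexx.
have e2 : e <= 2^-1 ^+ n / (`|c n| * B + 1) by rewrite ge_min lexx orbT.
split=> // j x lej; rewrite normrM.
have e1 : 0 < e <= 1.
  by rewrite e0 (le_trans en)// invf_le1 ?ltr0n// ler1n.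
apply: (@le_trans _ _ (`|c n| * (B * e * x ^+ 2))); first by rewrite ler_wpM2l// hB.
rewrite (mulrA `|c n|) (mulrA `|c n|) ler_wpM2r ?sqr_ge0//.
apply: (@le_trans _ _ ((`|c n| * B + 1) * e)); first by rewrite ler_wpM2r ?(ltW e0)// lerDl.
by rewrite mulrC -ler_pdivlMr.
Qed.

(** Since [eps n] tends to 0, the sum of the cut-off monomials is locally finite away from 0, and no
    uniform convergence is needed there. At 0, the bounds 2^-n x^2 make the tail of every
    differentiated sum quadratically small. *)
Theorem borel (c : nat -> R) : exists2 f : R -> R, smooth f & taylor_coef f =1 c.
Proof.
have [eps heps] := choose_eps c.
pose t := term c eps.
have e0 n : 0 < eps n by case: (heps n).
have t_bound n j x : (j + 3 <= n)%N -> `|t n j x| <= 2^-1 ^+ n * x ^+ 2.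
  by case: (heps n) => _ _; exact.
have t_supp n j x : eps n < `|x| -> t n j x = 0.
  rewrite /t /term => nx; suff -> : derive1n j (v (eps n) n) x = 0 by rewrite mulr0.
  elim: j x nx => [|j IH] x nx.
    rewrite /= /v plateau_eq0 ?mulr0// normrM normfV (gtr0_norm (e0 n)).
    by rewrite ler_pdivlMr// mul1r ltW.
  by rewrite derive1nS (derive1_supp IH).
have t0 n j : (j < n)%N -> t n j 0 = 0.
  move=> ltjn; rewrite /t /term; have [phi [_ _ ->//]] := derive1n_v (ltnW ltjn).
  by rewrite expr0n subn_eq0 leqNgt ltjn mul0r mulr0.
have dt n j x : is_derive x 1 (t n j) (t n j.+1 x).
  rewrite /t /term; apply: is_derive_scale; rewrite derive1nS.
  by rewrite derive1E; apply: DeriveDef => //; exact: smooth_v.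
(* All terms of index at least [N j x] vanish at x: for x different from 0 because of the supports,
   and at 0 (where 1/0 is 0 by convention) because n > j. *)
pose N j x := maxn j.+1 (Num.bound `|x^-1|).
have far n r : r != 0 -> (Num.bound `|r^-1| <= n)%N -> eps n < `|r|.
  move=> r0 le; case: (heps n) => _ h _; apply: le_lt_trans h _.
  rewrite -[`|r|]invrK ltf_pV2 ?posrE ?invr_gt0 ?normr_gt0 ?ltr0n//.
  rewrite -normfV (lt_le_trans (archi_boundP _))// ler_nat.
  exact: leqW.
have t_far j x n : (N j x <= n)%N -> t n j x = 0.
  rewrite geq_max => /andP[ltj le].
  have [->|x0] := eqVneq x 0; first exact: t0.
  by apply: t_supp; exact: far.
pose S j x := \sum_(n < N j x) t n j x.
have SE j x M : (forall n, (M <= n)%N -> t n j x = 0) -> S j x = \sum_(n < M) t n j x.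
  move=> h; rewrite /S.
  pose K := maxn M (N j x).
  have E P : (forall n, (P <= n)%N -> t n j x = 0) -> (P <= K)%N ->
      \sum_(n < P) t n j x = \sum_(n < K) t n j x.
    move=> hP le; rewrite (big_ord_widen K (fun n => t n j x) le) big_mkcond /=.
    by apply: eq_bigr => i _; case: ltnP => // /hP.
  rewrite (E (N j x)) ?leq_maxr//; last by move=> n; exact: t_far.
  by rewrite (E M) ?leq_maxl.
have geom K : \sum_(n < K) (2^-1 : R) ^+ n <= 2.
  elim: K => [|K IH]; first by rewrite big_ord0.
  have h m : \sum_(n < m) (2^-1 : R) ^+ n = 2 - 2 * 2^-1 ^+ m.
    elim: m => [|m IHm]; first by rewrite big_ord0 expr0 mulr1 subrr.
    by rewrite big_ord_recr /= IHm exprS; field.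
  by rewrite h gerBl mulr_ge0 ?exprn_ge0.
have dS j x : is_derive x 1 (S j) (S j.+1 x).
  have [->|x0] := eqVneq x 0.
    (* The terms below j + 3 are differentiated one by one; the others sum to at most 2 y^2 and
       contribute a zero derivative. *)
    pose P y := \sum_(n < j + 3) t n j y.
    have dP : is_derive (0 : R) 1 P (\sum_(n < j + 3) t n j.+1 0).
      exact: (is_derive_sum_ord _ (fun n => dt n j 0)).
    have dT : is_derive (0 : R) 1 (fun y => S j y - P y) 0.
      have bT y : `|S j y - P y| <= 2 * y ^+ 2.
        pose K := maxn (j + 3) (N j y).
        rewrite (SE j y K); last by move=> n; rewrite geq_max => /andP[_ /t_far].
        rewrite /P (big_ord_widen K (fun n => t n j y) (leq_maxl _ _)).
        rewrite [X in _ - X]big_mkcond -sumrB (le_trans (ler_norm_sum _ _ _))//.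
        apply: (@le_trans _ _ (\sum_(n < K) 2^-1 ^+ n * y ^+ 2)); last first.
          by rewrite -mulr_suml ler_wpM2r ?sqr_ge0.
        apply: ler_sum => n _; case: ltnP => le; last by rewrite subr0 t_bound.
        by rewrite subrr normr0 mulr_ge0 ?sqr_ge0// exprn_ge0.
      have T0 : S j 0 - P 0 = 0.
        by apply/eqP; rewrite -normr_le0 (le_trans (bT 0))// expr0n mulr0.
      apply: (@is_derive_quadratic _ _ _ 2) => y.
      by rewrite T0 mul0r !subr0.
    have := is_derive_add dP dT.
    have -> : (fun y => P y + (S j y - P y)) = S j by apply/funext => y; rewrite addrC subrK.
    move=> /is_derive_eq; apply; rewrite addr0 (SE j.+1 0 (j + 3)%N)//.
    by move=> n le; apply: t0; apply: leq_trans le; rewrite -addn2 leq_add2l.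
  (* For |y| > |x/2| the sum has the same finite set of possibly nonzero terms. *)
  have x20 : x / 2 != 0 by rewrite mulf_neq0// invr_eq0.
  pose M := Num.bound `|(x / 2)^-1|.
  have x2 : `|x / 2| < `|x|.
    rewrite normrM (gtr0_norm (_ : 0 < 2^-1)) ?invr_gt0// ltr_pdivrMr//.
    by rewrite ltr_pMr ?normr_gt0// ltr1n.
  apply: (near_eq_is_derive (f := fun y => \sum_(n < M) t n j y)).
    have : \forall y \near x, `|x / 2| < `|y|.
      exact: (@norm_continuous _ R x _ (lt_nbhsr x2)).
    apply: filterS => y xy; apply/esym/SE => n le; apply: t_supp.
    by apply: lt_trans xy; exact: far.
  have /is_derive_eq := is_derive_sum_ord M (fun n => dt n j x); apply.
  apply/esym/SE => n le; apply: t_supp; apply: lt_trans (far _ _ x20 le) x2.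
have sS : smooth (S 0%N).
  apply: (smooth_coind (P := fun f => exists j, f = S j)); last by exists 0%N.
  by move=> _ [j ->]; exists (S j.+1); [exists j.+1|exact: dS].
exists (S 0%N) => // j.
have Sn i : derive1n i (S 0%N) = S i.
  by elim: i => // i IH; rewrite derive1nS IH; exact: is_derive_derive1.
rewrite /taylor_coef Sn (SE j 0 j.+1); last by move=> n; exact: t0.
have tc n : t n j 0 / j`!%:R = c n * (j == n)%:R.
  rewrite /t /term -mulrA; congr (_ * _).
  rewrite -[LHS]/(taylor_coef (v (eps n) n) j) (@near_taylor_coef _ _ (fun x => ('X^n).[x])).
    by rewrite taylor_horner coefXn.
  by apply: filterS (plateau_near (e0 n)) => x xe; rewrite hornerXn /v xe mulr1.
rewrite mulr_suml (eq_bigr (fun n : 'I_j.+1 => c n * (j == n)%:R)) => [|n _]; last exact: tc.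
rewrite (bigD1 ord_max)//= eqxx mulr1 big1 ?addr0// => n nj.
by rewrite (_ : (j == n) = false) ?mulr0//; apply/negbTE; rewrite eq_sym.
Qed.

End Borel.

Lemma taylor_surj (R : realType) (x : formal_diffeo R) :
  exists d : diffeo R, taylor (germ_of d) = x.
Proof.
have [f sf fx] := borel x.
have f0 : f 0 = 0 by have := fx 0%N; rewrite /taylor_coef divr1 fcoef0.
have f1 : derive1 f 0 != 0.
  by have := fx 1%N; rewrite /taylor_coef divr1 /= => ->; exact: fcoef1.
have [d df] := diffeo_extension sf f0 f1.
exists d; apply: formal_diffeoP => n.
by rewrite taylorE (near_taylor_coef df).
Qed.

(** * Formal conjugacy equations *)

Section FormalComposition.
Variable F : numFieldType.
Implicit Types (f g h : nat -> F).

Lemma fcomp_sum f g n : g 0%N = 0 ->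
  fcomp f g n = \sum_(i < n.+1) f i * (trunc n g ^+ i)`_n.
Proof.
move=> g0; rewrite /fcomp (@coef_compE _ _ _ n n) ?coef_trunc//.
by apply: eq_bigr => i _; rewrite coef_trunc// -ltnS.
Qed.

Lemma fcompBl f g h n : h 0%N = 0 ->
  fcomp (fun i => f i - g i) h n = fcomp f h n - fcomp g h n.
Proof.
move=> h0; rewrite !fcomp_sum// -sumrB.
by apply: eq_bigr => i _; rewrite mulrBl.
Qed.

Lemma fcomp_scale f c n : fcomp f (fun i => c * fid F i) n = c ^+ n * f n.
Proof.
have c0 : c * fid F 0 = 0 by rewrite mulr0.
case: n => [|n]; first by rewrite fcomp0// mul1r.
rewrite /fcomp.
have -> : trunc n.+1 (fun i => c * fid F i) = c *: 'X.
  by rewrite -(@trunc_fid F n.+1)//; apply/polyP => i; rewrite coefZ !coef_poly; case: ifP; rewrite ?mulr0.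
rewrite (@coef_compE _ _ _ _ n.+1) ?coefZ ?coefX ?mulr0//.
rewrite (bigD1 ord_max)//= big1 ?addr0.
  by rewrite exprZn coefZ coefXn eqxx mulr1 coef_trunc// mulrC.
move=> i ni; rewrite exprZn coefZ coefXn.
by rewrite (_ : (n.+1 == i) = false) ?mulr0//; apply/negbTE; rewrite eq_sym.
Qed.

Lemma poly_factorXn (p : {poly F}) m : (forall i, (i < m)%N -> p`_i = 0) ->
  exists2 q, p = 'X^m * q & forall i, q`_i = p`_(m + i).
Proof.
move=> p0; exists (drop_poly m p); last by move=> i; rewrite coef_drop_poly addnC.
rewrite -{1}(poly_take_drop m p) mulrC [take_poly _ _](_ : _ = 0) ?add0r//.
by apply/polyP => i; rewrite coef_take_poly coef0; case: ifP => // /p0.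
Qed.

(** First-order expansion: for u = X(S + X^k Z) and w = X S, the difference of the powers is
    divisible by u - w = X^(k+1) Z, with quotient (i+1) w^i to leading order. *)
Lemma exprD_perturb (S Z : {poly F}) k i : (0 < k)%N ->
  exists2 W, ('X * (S + 'X^k * Z)) ^+ i.+1 - ('X * S) ^+ i.+1 = 'X^(k + i.+1) * W
    & W`_0 = i.+1%:R * S`_0 ^+ i * Z`_0.
Proof.
move=> k0; elim: i => [|i [W WE W0]].
  by exists Z; [rewrite !expr1 exprD; ring|rewrite expr0 !mul1r].
exists ((S + 'X^k * Z) * W + Z * S ^+ i.+1).
  have -> (u w : {poly F}) : u ^+ i.+2 - w ^+ i.+2 =
      u * (u ^+ i.+1 - w ^+ i.+1) + (u - w) * w ^+ i.+1 by rewrite (exprS u i.+1) (exprS w i.+1); ring.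
  by rewrite WE exprMn !exprD !exprS; ring.
rewrite coefD !coef0M coefD coef0M coefXn [(0 == k)%N]eq_sym (gtn_eqF k0) mul0r addr0.
rewrite W0 -(horner_coef0 (S ^+ i.+1)) horner_exp horner_coef0 -[i.+2]addn1 natrD exprS; ring.
Qed.

(** The increment is f'(g)(h - g) to first order, and f'(g) starts with (r+1) f_(r+1) g_1^r x^r.
    Terms quadratic in h - g come later because h - g has order at least 2. *)
Lemma fcomp_perturb f g h r k : (forall i, (i <= r)%N -> f i = 0) -> g 0%N = 0 ->
  (forall i, (i <= k.+1)%N -> h i = g i) ->
  (forall n, (n < k.+2 + r)%N -> fcomp f h n = fcomp f g n) /\
  fcomp f h (k.+2 + r) =
    fcomp f g (k.+2 + r) + r.+1%:R * f r.+1 * g 1%N ^+ r * (h k.+2 - g k.+2).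
Proof.
move=> f0 g0 hg; have h0 : h 0%N = 0 by rewrite hg.
have main n : exists2 W : nat -> {poly F}, forall i,
    ((trunc n h) ^+ i.+1 - (trunc n g) ^+ i.+1)`_n = ('X^(k.+1 + i.+1) * W i)`_n
    & (k.+2 <= n)%N -> forall i, (W i)`_0 = i.+1%:R * g 1%N ^+ i * (h k.+2 - g k.+2).
  have [|S SE S0] := @poly_factorXn (trunc n g) 1%N.
    by case=> // _; rewrite coef_trunc.
  have [|Z ZE Z0] := @poly_factorXn (trunc n h - trunc n g) k.+2.
    by move=> i ltik; rewrite coefB !coef_poly; case: ifP; rewrite ?hg ?subrr.
  have hE : trunc n h = 'X * (S + 'X^(k.+1) * Z).
    by rewrite -[LHS](subrK (trunc n g)) ZE SE expr1 [in 'X^(k.+2)]exprS; ring.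
  have /choice[W hW] : forall i, exists W, ('X * (S + 'X^(k.+1) * Z)) ^+ i.+1 - ('X * S) ^+ i.+1
     = 'X^(k.+1 + i.+1) * W /\ W`_0 = i.+1%:R * S`_0 ^+ i * Z`_0.
    by move=> i; have [W] := exprD_perturb S Z i (ltn0Sn k); exists W.
  exists W => [i|len i]; first by rewrite hE SE expr1; case: (hW i) => ->.
  case: (hW i) => _ ->; rewrite S0 Z0 !addn0 coefB !coef_trunc//.
  by apply: leq_trans len.
have diff n : fcomp f h n = fcomp f g n +
    \sum_(i < n.+1) f i * ((trunc n h) ^+ i - (trunc n g) ^+ i)`_n.
  rewrite !fcomp_sum// -big_split /=; apply: eq_bigr => i _.
  by rewrite -mulrDr coefB addrC subrK.
have term0 n (i : nat) : (n < k.+2 + r)%N || (i != r.+1) -> (n <= k.+2 + r)%N ->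
    f i * ((trunc n h) ^+ i - (trunc n g) ^+ i)`_n = 0.
  move=> ni len; have [ir|] := leqP i r; first by rewrite f0// mul0r.
  case: i ni => // i ni; rewrite ltnS => ri.
  have [W -> _] := main n; rewrite coefXnM ifT ?mulr0//.
  have [Ei|ri'] := eqVneq i r.
    by move: ni; rewrite Ei eqxx orbF addSnnS.
  rewrite (leq_ltn_trans len)// addSnnS ltn_add2l.
  by rewrite ltnS ltn_neqAle eq_sym ri' ri.
split=> [n ltn|].
  by rewrite diff big1 ?addr0// => i _; apply: term0; rewrite ?ltn// ltnW.
rewrite diff; congr (_ + _).
have lt : (r.+1 < (k.+2 + r).+1)%N by rewrite ltnS addSn ltnS leq_addl.
rewrite (bigD1 (Ordinal lt))//= big1 ?addr0; last first.
  by move=> i ir; apply: term0 => //; rewrite orbC; apply/orP; left.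
have [W -> W0] := main (k.+2 + r)%N; rewrite coefXnM addSnnS ltnn subnn.
by rewrite W0 ?leq_addr//; ring.
Qed.

(** The coefficient f_k first enters the equation at index q + k, affinely with slope [d k], so the
    equations are solved one after the other. *)
Lemma triangular_solve (E : (nat -> F) -> nat -> F) q k0 (d : nat -> F) f0 :
  (forall f g k, (k0 <= k)%N -> (forall i, (i < k0)%N -> f i = f0 i) ->
     (forall i, (i < k)%N -> g i = f i) ->
     (forall n, (n < q + k)%N -> E g n = E f n) /\
     E g (q + k)%N = E f (q + k)%N + d k * (g k - f k)) ->
  exists f, [/\ forall i, (i < k0)%N -> f i = f0 i,
    forall n, (n < q + k0)%N -> E f n = E f0 n
    & forall k, (k0 <= k)%N -> d k != 0 -> E f (q + k)%N = 0].
Proof.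
move=> HE.
(* If [d k] is 0 the quotient is 0 by convention: f_k keeps its value and the equation q + k is not
   claimed. *)
pose step k f i := if (i == k) && (k0 <= k)%N then f k - E f (q + k)%N / d k else f i.
pose chi := fix chi n := if n is m.+1 then step m (chi m) else f0.
have chiS n i : i != n -> chi n.+1 i = chi n i by move=> /negbTE ni; rewrite /= /step ni.
have chi_stable m n i : (i < m)%N -> (m <= n)%N -> chi n i = chi m i.
  move=> im; elim: n => [|n IH]; first by rewrite leqn0 => /eqP->.
  rewrite leq_eqVlt => /predU1P[->//|lemn]; rewrite chiS ?IH//.
  by rewrite ltn_eqF// (leq_trans im).
have chi0 n i : (i < k0)%N -> chi n i = f0 i.
  move=> ik; elim: n => // n IH; rewrite /= /step; case: eqP => //= En.
  by rewrite -[X in (_ <= X)%N]En leqNgt ik.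
pose f i := chi i.+1 i.
have fchi n i : (i < n)%N -> f i = chi n i by move=> lt; rewrite (chi_stable i.+1 n).
exists f; split.
- by move=> i ik; rewrite /f chi0.
- move=> n ltn; have ag i : (i < k0)%N -> f i = f0 i by move=> ik; rewrite /f chi0.
  by have [h _] := HE f0 f k0 (leqnn _) (fun _ _ => erefl) ag; exact: h.
move=> k k0k dk.
have [h _] := HE (chi k.+1) f k.+1 (leqW k0k) (chi0 _) (fchi _).
rewrite h; last by rewrite addnS.
have ag i : (i < k)%N -> chi k.+1 i = chi k i by move=> ik; rewrite chiS// ltn_eqF.
have [_ ->] := HE (chi k) (chi k.+1) k k0k (chi0 _) ag.
by rewrite /= /step eqxx k0k /= addrAC subrr add0r mulrN mulrC divfK ?subrr.
Qed.

(** With mu the multiplier of h, the equation h o f = f o (mu x) is triangular with diagonal mu -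
    mu^k, nonzero for k > 1 by hypothesis. *)
Lemma linearize (h : nat -> F) : h 0%N = 0 -> (forall k, (1 < k)%N -> h 1%N ^+ k != h 1%N) ->
  exists f, [/\ f 0%N = 0, f 1%N = 1
    & fcomp h f =1 fcomp f (fun i => h 1%N * fid F i)].
Proof.
move=> h0 hk; set mu := h 1%N.
pose E f n := fcomp h f n - fcomp f (fun i => mu * fid F i) n.
have [|f [f01 Elt Ege]] := @triangular_solve E 0 2 (fun k => mu - mu ^+ k) (fid F).
  move=> f g [|[|k]]// _ f01 gf; rewrite add0n.
  have f0 : f 0%N = 0 by rewrite f01.
  have [Hlt Heq] := @fcomp_perturb (fun i => h i) f g 0 k ltac:(by case=> // _; rewrite h0) f0 gf.
  rewrite addn0 in Hlt Heq.
  split=> [n ltn|]; rewrite /E !fcomp_scale; first by rewrite Hlt// gf.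
  by rewrite Heq expr0 -/mu; ring.
have f0 : f 0%N = 0 by rewrite f01.
have f1 : f 1%N = 1 by rewrite f01.
exists f; split=> // -[|[|n]].
- by rewrite !fcomp0// ?mulr0// f0.
- by rewrite !fcomp1// ?mulr0// f1 /fid eqxx !mulr1 mul1r.
apply/eqP; rewrite -subr_eq0; apply/eqP; apply: (Ege n.+2) => //.
by rewrite subr_eq0 eq_sym hk.
Qed.

(* The resonance k = p + 1 of the conjugacy equation is absorbed by the
   coefficient of index 2p + 1 of the target. *)
Lemma conj_normal (h : nat -> F) p : (0 < p)%N -> h 1%N = 1 -> h p.+1 != 0 ->
  (forall i, (i <= p)%N -> i != 1%N -> h i = 0) ->
  exists e : F, forall b : nat -> F,
    (forall i, (i <= p.*2)%N -> b i = fid F i + (i == p.+1)%:R * h p.+1) ->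
    b p.*2.+1 = e ->
    exists f, [/\ f 0%N = 0, f 1%N = 1 & fcomp h f =1 fcomp f b].
Proof.
move=> p0 h1 hp0 hi; set a := h p.+1.
have h0 : h 0%N = 0 by rewrite hi.
pose b1 i := fid F i + (i == p.+1)%:R * a.
pose E b f n := fcomp h f n - fcomp f b n.
(* A change of f_k is multiplied by (p+1) a in h o f - f and by k a in f o b - f, both at index p +
   k. The difference vanishes for k = p + 1, that is at index 2p + 1. *)
pose d k : F := (p.+1%:R - k%:R) * a.
have key b f g k : (forall i, (i <= p.+1)%N -> b i = b1 i) -> (1 < k)%N ->
    f 0%N = 0 -> f 1%N = 1 -> (forall i, (i < k)%N -> g i = f i) ->
    (forall n, (n < p + k)%N -> E b g n = E b f n) /\
    E b g (p + k)%N = E b f (p + k)%N + d k * (g k - f k).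
  case: k => [|[|k]]// bb1 _ f0 f1 gf.
  have g0 : g 0%N = 0 by rewrite gf.
  have b0 : b 0%N = 0 by rewrite bb1 // /b1 /fid /= mul0r addr0.
  have [h1lt h1eq] : (forall n, (n < k.+2 + p)%N ->
      fcomp (fun i => h i - fid F i) g n = fcomp (fun i => h i - fid F i) f n) /\
      fcomp (fun i => h i - fid F i) g (k.+2 + p) = fcomp (fun i => h i - fid F i) f (k.+2 + p)
      + p.+1%:R * a * (g k.+2 - f k.+2).
    have [|A B] := @fcomp_perturb (fun i => h i - fid F i) f g p k _ f0 gf.
      move=> i lei; rewrite /fid; case: eqVneq => [->|i1]; first by rewrite h1 subrr.
      by rewrite hi// subrr.
    split=> //; rewrite B f1 expr1n mulr1 /fid /= eqSS.
    by rewrite (gtn_eqF p0) subr0.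
  have [h2lt h2eq] : (forall n, (n < p.+1 + k.+1)%N ->
      fcomp (fun i => g i - f i) b n = g n - f n) /\
      fcomp (fun i => g i - f i) b (p.+1 + k.+1) = g (p.+1 + k.+1)%N - f (p.+1 + k.+1)%N
      + k.+2%:R * (g k.+2 - f k.+2) * a.
    case: p p0 @a hp0 hi @b1 @d bb1 h1lt h1eq => // p _ a hp0 hi b1 d bb1 _ _.
    have [|||A B] := @fcomp_perturb (fun i => g i - f i) (fid F) b k.+1 p _ _ _.
    - by move=> i lei; rewrite gf ?subrr.
    - by [].
    - move=> i lei; rewrite bb1; last by rewrite leqW.
      by rewrite /b1 ltn_eqF ?mul0r ?addr0.
    split=> [n ltn|]; first by rewrite A// fcompf1.
    rewrite B fcompf1 /fid /= expr1n mulr1 bb1// /b1 eqxx mul1r /fid /=.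
    by rewrite add0r subr0.
  have EE f' n : f' 0%N = 0 -> E b f' n =
      fcomp (fun i => h i - fid F i) f' n + f' n - fcomp f' b n.
    by move=> f'0; rewrite fcompBl// fcomp1f// subrK.
  have BB n : fcomp g b n = fcomp f b n + fcomp (fun i => g i - f i) b n.
    by rewrite fcompBl// addrC subrK.
  have Ek : (p + k.+2 = k.+2 + p)%N by rewrite addnC.
  have Ep : (p + k.+2 = p.+1 + k.+1)%N by rewrite addnS addSn addnS.
  split=> [n ltn|].
    by rewrite !EE// BB h1lt -?Ek// h2lt -?Ep//; ring.
  by rewrite -Ek in h1eq; rewrite -Ep in h2eq; rewrite !EE// BB h1eq h2eq /d; ring.
have bb1 i : (i <= p.+1)%N -> b1 i = b1 i by [].
(* With [b1], which has no term of index 2p + 1, every equation can be solved except the resonant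
   one. *)
have [|f1 [f01 f1lt f1eq]] := @triangular_solve (E b1) p 2 d (fid F).
  by move=> f g k lek f01 gf; apply: key => //; rewrite f01.
have f10 : f1 0%N = 0 by rewrite f01.
have f11 : f1 1%N = 1 by rewrite f01.
have Ef1 n : n != p.*2.+1 -> E b1 f1 n = 0.
  have [ltn|] := ltnP n (p + 2).
    move=> _; rewrite f1lt// /E fcompf1 fcomp1f; last by rewrite /b1 /fid /= mul0r addr0.
    rewrite /b1 /fid; case: (eqVneq n 1%N) => [->|n1].
      by rewrite h1 eqSS (ltn_eqF p0) mul0r addr0 subrr.
    case: (eqVneq n p.+1) => [->|np]; first by rewrite mul1r add0r subrr.
    rewrite hi ?mul0r ?addr0 ?subrr//.
    by rewrite -ltnS ltn_neqAle np -ltnS -addn2.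
  move=> len nr; rewrite -(subnKC (leq_trans (leq_addr _ _) len)) f1eq//.
    by rewrite leq_subRL// (leq_trans _ len)// leq_addr.
  rewrite /d mulf_neq0// subr_eq0 eqr_nat; apply: contra nr => /eqP k.
  rewrite -(subnKC (leq_trans (leq_addr _ _) len)) -k.
  by rewrite addnS addnn.
(* The remaining defect is the required coefficient: f1 is tangent to the identity, so setting
   b_(2p+1) to it cancels the defect. *)
exists (E b1 f1 p.*2.+1) => b blt be.
have lep : (p.+1 <= p.*2)%N by rewrite -addnn -addn1 leq_add2l.
have b0 : b 0%N = 0 by rewrite blt// /fid /= mul0r addr0.
have bbE i : (i <= p.+1)%N -> b i = b1 i by move=> ip; rewrite blt// (leq_trans ip).
have [Blt Beq] : (forall n, (n < p.*2.+1)%N -> fcomp f1 b n = fcomp f1 b1 n) /\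
    fcomp f1 b p.*2.+1 = fcomp f1 b1 p.*2.+1 + b p.*2.+1.
  have E2 : (p.*2.+1 = (p.*2.-1).+2)%N by rewrite prednK // double_gt0.
  have b10 : b1 0%N = 0 by rewrite /b1 /fid /= mul0r addr0.
  have [||A B] := @fcomp_perturb f1 b1 b 0%N p.*2.-1 _ b10 _.
  - by case.
  - by move=> i le; rewrite blt // (leq_trans le)// prednK // double_gt0.
  rewrite addn0 -E2 in A B; split=> //; rewrite B expr0 f11 !mulr1 mul1r.
  rewrite /b1 /fid [_ == p.+1](_ : _ = false); last by rewrite gtn_eqF// ltnS.
  by rewrite mul0r addr0 E2 subr0.
have Eb n : (n <= p.*2.+1)%N -> E b f1 n = 0.
  rewrite leq_eqVlt => /predU1P[->|ltn]; last first.
    by rewrite /E Blt// -/(E b1 f1 n) Ef1// ltn_eqF.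
  by rewrite /E Beq be /E; ring.
(* Equations up to index 2p + 1 now hold for [f1]. Changing coefficients from p + 2 on preserves
   them and meets no resonance. *)
have [|f [flt fElt fEge]] := @triangular_solve (E b) p p.+2 d f1.
  by move=> f g k lek f01' gf; apply: key => //; [exact: leq_trans lek|rewrite f01'|rewrite f01'].
exists f; split; [by rewrite flt|by rewrite flt|move=> n].
apply/eqP; rewrite -subr_eq0; apply/eqP; rewrite -/(E b f n).
have [ltn|len] := ltnP n (p + p.+2); first by rewrite fElt// Eb// -ltnS -addnn -!addnS.
rewrite -(subnKC (leq_trans (leq_addr _ _) len)).
have lek : (p.+2 <= n - p)%N by rewrite leq_subRL// (leq_trans _ len)// leq_addr.
by rewrite fEge// /d mulf_neq0// subr_eq0 eqr_nat ltn_eqF.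
Qed.

End FormalComposition.

(** * Equality up to flat functions and the Julia equation *)

Section FlatEquality.
Variable R : realType.
Implicit Types (f g h A B b : R -> R).

Lemma taylor_mul f g n : smooth f -> smooth g ->
  taylor_coef (fun x => f x * g x) n =
  \sum_(i < n.+1) taylor_coef f i * taylor_coef g (n - i).
Proof.
move=> sf sg; rewrite [LHS](taylorM n sf sg) coefM; apply: eq_bigr => i _.
by rewrite !coef_trunc ?leq_subr// -ltnS.
Qed.

Lemma taylor_cst (c : R) n : taylor_coef (fun=> c) n = c * (n == 0%N)%:R.
Proof.
have -> : (fun=> c) = (fun x : R => (c%:P).[x]) by apply/funext => x; rewrite hornerC.
by rewrite taylor_horner coefC; case: eqP; rewrite ?mulr1 ?mulr0.
Qed.

Lemma taylor_scale c f n : smooth f -> taylor_coef (fun x => c * f x) n = c * taylor_coef f n.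
Proof.
move=> sf; rewrite (taylor_mul n (@smooth_cst R c) sf) big_ord_recl taylor_cst subn0 mulr1.
by rewrite big1 ?addr0// => i _; rewrite taylor_cst /= mulr0 mul0r.
Qed.

Lemma taylor_sub f g n : smooth f -> smooth g ->
  taylor_coef (fun x => f x - g x) n = taylor_coef f n - taylor_coef g n.
Proof.
move=> sf sg; have sg' : smooth (fun x => -1 * g x) by smoothness.
have -> : (fun x => f x - g x) = f \+ (fun x => -1 * g x).
  by apply/funext => x; rewrite /= mulN1r.
by rewrite (taylorD n sf sg') taylor_scale// mulN1r.
Qed.

Lemma taylor_Xn_mul k f n : smooth f -> taylor_coef (fun x => x ^+ k * f x) n =
  if (n < k)%N then 0 else taylor_coef f (n - k).
Proof.
move=> sf; have sX : smooth (fun x : R => x ^+ k) by smoothness.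
have tX i : taylor_coef (fun x : R => x ^+ k) i = (i == k)%:R.
  have -> : (fun x : R => x ^+ k) = (fun x => ('X^k).[x]).
    by apply/funext => x; rewrite hornerXn.
  by rewrite taylor_horner coefXn.
rewrite taylor_mul//; case: ltnP => [ltnk|lek].
  rewrite big1// => i _; rewrite tX ltn_eqF ?mul0r//.
  by apply: leq_trans ltnk; rewrite ltnS -ltnS.
rewrite -ltnS in lek; rewrite (bigD1 (Ordinal lek))//= tX eqxx mul1r big1 ?addr0//.
move=> i ik; rewrite tX (_ : (i == k :> nat) = false) ?mul0r//.
by apply/negbTE.
Qed.

Lemma taylor_coef_idx0 f : taylor_coef f 0%N = f 0.
Proof. by rewrite /taylor_coef divr1. Qed.

Lemma taylor_coef_idx1 f : taylor_coef f 1%N = derive1 f 0.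
Proof. by rewrite /taylor_coef divr1. Qed.

Lemma taylor_id n : taylor_coef (fun x : R => x) n = fid R n.
Proof.
have -> : (fun x : R => x) = (fun x => ('X).[x]) by apply/funext => x; rewrite hornerX.
by rewrite taylor_horner coefX.
Qed.

(** Equality of formal series, carried by smooth functions: smoothness is what makes the expansion
    compatible with products, composition and derivatives. *)
Definition flat_eq f g := [/\ smooth f, smooth g & taylor_coef f = taylor_coef g].

Lemma flat_eq_refl f : smooth f -> flat_eq f f.
Proof. by []. Qed.

Lemma flat_eq_sym f g : flat_eq f g -> flat_eq g f.
Proof. by case. Qed.

Lemma flat_eq_trans g f h : flat_eq f g -> flat_eq g h -> flat_eq f h.
Proof. by move=> [sf _ fg] [_ sh gh]; split=> //; rewrite fg. Qed.

Lemma flat_eq_near f g : smooth f -> smooth g -> (\forall x \near (0 : R), f x = g x) ->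
  flat_eq f g.
Proof. by move=> sf sg fg; split=> //; apply/funext => n; exact: near_taylor_coef. Qed.

Lemma flat_eqM f f' g g' : flat_eq f f' -> flat_eq g g' ->
  flat_eq (fun x => f x * g x) (fun x => f' x * g' x).
Proof.
move=> [sf sf' ff] [sg sg' gg]; split; try exact: smooth_mul.
by apply/funext => n; rewrite !taylor_mul// ff gg.
Qed.

Lemma flat_eqB f f' g g' : flat_eq f f' -> flat_eq g g' ->
  flat_eq (fun x => f x - g x) (fun x => f' x - g' x).
Proof.
move=> [sf sf' ff] [sg sg' gg]; split; try exact: smooth_sub.
by apply/funext => n; rewrite !taylor_sub// ff gg.
Qed.

Lemma flat_eq_scale c f g : flat_eq f g -> flat_eq (fun x => c * f x) (fun x => c * g x).
Proof. by move=> fg; apply: flat_eqM fg; apply: flat_eq_refl; exact: smooth_cst. Qed.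

Lemma flat_eq_comp f f' g g' : flat_eq f f' -> flat_eq g g' -> g 0 = 0 ->
  flat_eq (fun x => f (g x)) (fun x => f' (g' x)).
Proof.
move=> [sf sf' ff] [sg sg' gg] g0; split; try exact: smooth_comp_fun.
have g'0 : g' 0 = 0 by rewrite -taylor_coef_idx0 -gg taylor_coef_idx0.
by apply/funext => n; rewrite [LHS](taylor_comp n sf sg g0) [RHS](taylor_comp n sf' sg' g'0) ff gg.
Qed.

Lemma flat_eq_derive f g : flat_eq f g -> flat_eq (derive1 f) (derive1 g).
Proof.
move=> [sf sg fg]; split; try exact: smooth_derive1.
by apply/funext => n; rewrite -!taylor_derive fg.
Qed.

Lemma derive1_comp_fun f g x : smooth f -> smooth g ->
  derive1 (fun x => f (g x)) x = derive1 f (g x) * derive1 g x.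
Proof.
by move=> sf sg; apply: derive1_val; apply: is_derive_comp; exact: smooth_is_derive.
Qed.

Definition tangent_id q (b : R -> R) := forall i, (i <= q)%N -> taylor_coef b i = fid R i.

(* The Julia operator A |-> A o b - b' A is triangular for the order of
   vanishing, and its diagonal vanishes exactly at the order q + 1. *)
Lemma julia_coef A b q j : smooth A -> smooth b -> (0 < q)%N -> tangent_id q b ->
  (0 < j)%N -> (forall i, (i < j)%N -> taylor_coef A i = 0) ->
  (forall n, (n < q + j)%N -> taylor_coef (fun x => A (b x) - derive1 b x * A x) n = 0) /\
  taylor_coef (fun x => A (b x) - derive1 b x * A x) (q + j) =
    (j%:R - q.+1%:R) * taylor_coef b q.+1 * taylor_coef A j.
Proof.
move=> sA sb q0 bq j0 Aj.
have b0 : b 0 = 0 by rewrite -taylor_coef_idx0 bq.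
have sb' := smooth_derive1 sb.
have sAb : smooth (fun x => A (b x)) by exact: smooth_comp_fun.
have sbA : smooth (fun x => derive1 b x * A x) by exact: smooth_mul.
have b'E i : taylor_coef (derive1 b) i = i.+1%:R * taylor_coef b i.+1.
  by rewrite mulr_natl; exact: esym (taylor_derive b i).
have bump0 k : bump 0 k = k.+1 by [].
(* As b' = 1 + (q+1) b_(q+1) x^q + ..., multiplication by b' first alters A at the index q + j. *)
have prodE n : (n <= q + j)%N -> taylor_coef (fun x => derive1 b x * A x) n =
    taylor_coef A n + (n == q + j)%:R * (q.+1%:R * taylor_coef b q.+1 * taylor_coef A j).
  move=> len; rewrite taylor_mul// big_ord_recl /= subn0 b'E bq// mulr1 mul1r; congr (_ + _).
  have [En|nn] := eqVneq n (q + j)%N.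
    have lt : (q.-1 < n)%N by rewrite En prednK// leq_addr.
    rewrite (bigD1 (Ordinal lt))//= big1 ?addr0.
      by rewrite mul1r b'E bump0 prednK// En addKn.
    move=> i iq; rewrite /= b'E; have [le|lt'] := leqP i q.-1.
      have lt2 : (i < q.-1)%N by rewrite ltn_neqAle le andbT.
      by rewrite bump0 bq ?/fid ?mulr0 ?mul0r// -(prednK q0) ltnS.
    rewrite Aj ?mulr0// bump0 ltn_subLR//; apply: (@leq_ltn_trans (q + j)); first by rewrite -En.
    by rewrite ltn_add2r ltnS; move: lt'; rewrite prednK.
  rewrite mul0r big1// => i _; rewrite b'E.
  have ltn : (n < q + j)%N by rewrite ltn_neqAle nn.
  have [le|lt'] := leqP i.+2 q; first by rewrite bq// /fid mulr0 mul0r.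
  rewrite Aj ?mulr0// bump0 ltn_subLR//.
  by apply: leq_trans ltn _; rewrite leq_add2r -ltnS.
(* Composition with b instead of the identity changes A at the same index, by j A_j b_(q+1). *)
have [|||Hlt Heq] := @fcomp_perturb R (taylor_coef A) (fid R) (taylor_coef b) j.-1 q.-1 _ _ _.
- by move=> i le; apply: Aj; rewrite -(prednK j0) ltnS.
- by [].
- by move=> i le; apply: bq; rewrite -(prednK q0).
have Eqj : (q.-1.+2 + j.-1 = q + j)%N by rewrite prednK// addSnnS prednK.
rewrite Eqj in Hlt Heq.
have AbE n : taylor_coef (fun x => A (b x)) n = fcomp (taylor_coef A) (taylor_coef b) n.
  exact: (taylor_comp n sA sb b0).
split=> [n ltn|].
  by rewrite taylor_sub// prodE ?(ltnW ltn)// AbE Hlt// fcompf1 (ltn_eqF ltn) mul0r addr0 subrr.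
rewrite taylor_sub// prodE// AbE Heq fcompf1 eqxx !prednK//.
have -> : fid R q.+1 = 0 by rewrite /fid eqSS gtn_eqF.
have -> : fid R 1 = 1 by [].
rewrite expr1n /=; ring.
Qed.

Lemma julia_order A b q j : flat_eq (fun x => A (b x)) (fun x => derive1 b x * A x) ->
  smooth A -> smooth b -> (0 < q)%N -> tangent_id q b -> taylor_coef b q.+1 != 0 ->
  (0 < j)%N -> (forall i, (i < j)%N -> taylor_coef A i = 0) -> taylor_coef A j != 0 ->
  j = q.+1.
Proof.
move=> [s1 s2 E] sA sb q0 bq bq1 j0 Aj Aj0.
have [_] := julia_coef sA sb q0 bq j0 Aj.
rewrite taylor_sub// E subrr => /esym/eqP; rewrite mulf_eq0 (negbTE Aj0) orbF.
by rewrite mulf_eq0 (negbTE bq1) orbF subr_eq0 eqr_nat => /eqP.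
Qed.

(** Subtracting c B cancels the coefficient of order q + 1. The difference still solves the
    equation, and a nonzero solution vanishing at 0 has order q + 1. *)
Lemma julia_unique A B b q : flat_eq (fun x => A (b x)) (fun x => derive1 b x * A x) ->
  flat_eq (fun x => B (b x)) (fun x => derive1 b x * B x) ->
  smooth A -> smooth B -> smooth b -> (0 < q)%N -> tangent_id q b -> taylor_coef b q.+1 != 0 ->
  A 0 = 0 -> B 0 = 0 -> taylor_coef B q.+1 != 0 ->
  exists c, flat_eq A (fun x => c * B x).
Proof.
move=> JA JB sA sB sb q0 bq bq1 A0 B0 Bq.
pose c := taylor_coef A q.+1 / taylor_coef B q.+1; exists c.
have scB : smooth (fun x => c * B x) by smoothness.
pose D x := A x - c * B x.
have sD : smooth D by exact: smooth_sub.
have sb' := smooth_derive1 sb.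
have JD : flat_eq (fun x => D (b x)) (fun x => derive1 b x * D x).
  have := flat_eqB JA (flat_eq_scale c JB).
  have -> : (fun x => derive1 b x * A x - c * (derive1 b x * B x)) = (fun x => derive1 b x * D x).
    by apply/funext => x; rewrite /D mulrBr mulrCA.
  by [].
suff D0 n : taylor_coef D n = 0.
  split=> //; apply/funext => n; apply/eqP; rewrite -subr_eq0 -taylor_sub//.
  exact/eqP/D0.
apply/eqP; apply: contrapT => /negP Dn.
have exn : exists n, taylor_coef D n != 0 by exists n.
case: (ex_minnP exn) => j Dj jmin.
have j0 : (0 < j)%N.
  case: j Dj {jmin} => //; rewrite taylor_coef_idx0 /D A0 B0 mulr0 subrr.
  by rewrite eqxx.
have Dlt i : (i < j)%N -> taylor_coef D i = 0.
  by move=> ij; apply/eqP; apply: contraTT ij => /jmin; rewrite -leqNgt.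
have Ej := julia_order JD sD sb q0 bq bq1 j0 Dlt Dj.
by move: Dj; rewrite Ej /D taylor_sub// taylor_scale// /c divfK// subrr eqxx.
Qed.

Lemma tangent_index b : b 0 = 0 -> derive1 b 0 = 1 -> taylor_coef b <> fid R ->
  exists q, [/\ (0 < q)%N, tangent_id q b & taylor_coef b q.+1 != 0].
Proof.
move=> b0 b1 nb.
have exn : exists n, taylor_coef b n != fid R n.
  apply: contrapT => h; apply: nb; apply/funext => n; apply/eqP.
  by apply: contrapT => /negP hn; apply: h; exists n.
case: (ex_minnP exn) => -[|[|q]] Hq qmin.
- by move: Hq; rewrite taylor_coef_idx0 b0 eqxx.
- by move: Hq; rewrite taylor_coef_idx1 b1 eqxx.
exists q.+1; split=> //; move=> i iq; apply/eqP; apply: contraTT iq => /qmin.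
by rewrite -ltnNge.
Qed.

Lemma taylor_comp_lead A b j : smooth A -> smooth b -> b 0 = 0 ->
  (forall i, (i < j)%N -> taylor_coef A i = 0) ->
  taylor_coef (fun x => A (b x)) j = taylor_coef A j * derive1 b 0 ^+ j.
Proof.
move=> sA sb b0 Aj; have tb0 : taylor_coef b 0%N = 0 by rewrite taylor_coef_idx0.
rewrite [LHS](taylor_comp j sA sb b0) fcomp_sum//.
rewrite (bigD1 ord_max)//= big1 ?addr0; last first.
  move=> i ij; rewrite Aj ?mul0r//.
  by rewrite ltn_neqAle -ltnS ltn_ord andbT; apply: contra ij => /eqP E; apply/eqP/val_inj.
rewrite coefX_diag; last by rewrite coef_trunc.
case: j {Aj} => [|j]; first by rewrite !expr0.
by rewrite coef_trunc// taylor_coef_idx1.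
Qed.

Lemma taylor_mul_lead f A j : smooth f -> smooth A ->
  (forall i, (i < j)%N -> taylor_coef A i = 0) ->
  taylor_coef (fun x => f x * A x) j = f 0 * taylor_coef A j.
Proof.
move=> sf sA Aj; rewrite taylor_mul// big_ord_recl subn0 taylor_coef_idx0 big1 ?addr0//.
by move=> i _; rewrite Aj ?mulr0// lift0; have := ltn_ord i; case: j i {Aj} => [[]|j i] // _; rewrite subSS ltnS leq_subr.
Qed.

End FlatEquality.

(** * Flows of normal form vector fields *)

Section NormalForm.
Variables (R : realType) (p : nat) (p0 : (0 < p)%N) (lam : R).
Implicit Types (x y k t : R).

(* The vector field dual to the form (x^-(p+1) + lam / x) dx; the cutoff only
   serves to make its coefficient a smooth function on the whole line. *)
Definition nf_unit x : R := (1 + cutoff 2^-1 (lam * x ^+ p))^-1.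
Definition nf x : R := x ^+ p.+1 * nf_unit x.

Lemma nf_den_gt0 x : 0 < 1 + cutoff 2^-1 (lam * x ^+ p).
Proof.
have := @cutoff_le R 2^-1 (lam * x ^+ p) ltac:(lra).
rewrite ler_norml => /andP[h _]; lra.
Qed.

Lemma smooth_nf_unit : smooth nf_unit.
Proof.
apply: smooth_inv => [|x]; last by rewrite gt_eqF// nf_den_gt0.
have s : smooth (fun x => cutoff 2^-1 (lam * x ^+ p)).
  by apply: (smooth_comp_fun (@smooth_cutoff R 2^-1)); smoothness.
smoothness.
Qed.

Lemma smooth_nf : smooth nf.
Proof. by have s := smooth_nf_unit; rewrite /nf; smoothness. Qed.

Lemma monomial_cvg0 c : c * x ^+ p @[x --> (0 : R)] --> 0.
Proof.
have s : smooth (fun x => c * x ^+ p) by smoothness.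
by have := smooth_continuous s (x := 0); rewrite /continuous_at expr0n (gtn_eqF p0) mulr0.
Qed.

Lemma nf_unit_near : \forall x \near (0 : R),
  0 < 1 + lam * x ^+ p /\ nf_unit x = (1 + lam * x ^+ p)^-1.
Proof.
have h2 : 0 < 2^-1 :> R by rewrite invr_gt0.
have : \forall x \near (0 : R), cutoff 2^-1 (lam * x ^+ p) = lam * x ^+ p.
  exact: (monomial_cvg0 lam (cutoff_id h2)).
apply: filterS => x xE; have := nf_den_gt0 x.
by rewrite /nf_unit xE.
Qed.

Lemma nf_near : \forall x \near (0 : R),
  0 < 1 + lam * x ^+ p /\ nf x = x ^+ p.+1 / (1 + lam * x ^+ p).
Proof. by apply: filterS nf_unit_near => x [h xE]; rewrite /nf xE. Qed.

Lemma nf_unit0 : nf_unit 0 = 1.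
Proof. by rewrite /nf_unit expr0n (gtn_eqF p0) mulr0 cutoff0 addr0 invr1. Qed.

Lemma taylor_nf_lt i : (i < p.+1)%N -> taylor_coef nf i = 0.
Proof. by move=> ip; rewrite (taylor_Xn_mul _ _ smooth_nf_unit) ip. Qed.

Lemma taylor_nf_lead : taylor_coef nf p.+1 = 1.
Proof.
by rewrite (taylor_Xn_mul _ _ smooth_nf_unit) ltnn subnn taylor_coef_idx0 nf_unit0.
Qed.

Lemma nf0 : nf 0 = 0.
Proof. by rewrite /nf expr0n mul0r. Qed.

Lemma near_derive1 (f g : R -> R) : (\forall x \near (0 : R), f x = g x) ->
  \forall x \near (0 : R), derive1 f x = derive1 g x.
Proof.
move=> fg; apply: filterS (near_join fg) => x h.
by rewrite !derive1E; exact: near_eq_derive.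
Qed.

(* w is the inverse function of w |-> (1 - exp(-w)) / (t - lam w). *)
Lemma flow_exists t : t != 0 -> exists w : R -> R, [/\ smooth w, w 0 = 0,
    \forall y \near (0 : R), 1 - expR (- w y) = y * (t - lam * w y)
  & forall v : R -> R, v x @[x --> (0 : R)] --> 0 ->
      (\forall x \near (0 : R), 1 - expR (- v x) = x ^+ p * (t - lam * v x)) ->
      \forall x \near (0 : R), v x = w (x ^+ p)].
Proof.
move=> tn0.
have l0 : 0 < `|lam| + 1 by rewrite ltr_wpDl.
(* Then |lam| e < |t|, so the denominator [s] vanishes nowhere. *)
pose e := `|t| / (2 * (`|lam| + 1)).
have e0 : 0 < e by rewrite divr_gt0 ?normr_gt0// mulr_gt0.
pose s x := t - lam * cutoff e x.
have s0 x : s x != 0.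
  rewrite /s; apply/eqP => /eqP; rewrite subr_eq0 => /eqP tE.
  have : `|t| <= `|lam| * e by rewrite {1}tE normrM ler_wpM2l// cutoff_le.
  apply/negP; rewrite -ltNge.
  apply: (@le_lt_trans _ _ (`|t| / 2)); last first.
    by rewrite ltr_pdivrMr// ltr_pMr ?normr_gt0// ltr1n.
  have -> : `|lam| * e = `|t| / 2 * (`|lam| / (`|lam| + 1)).
    by rewrite /e; field; rewrite gt_eqF.
  rewrite ler_piMr ?divr_ge0//.
  by rewrite ler_pdivrMr// mul1r lerDl.
have ss : smooth s by have sc := @smooth_cutoff R e; rewrite /s; smoothness.
have sV := smooth_inv ss s0.
pose Y x := (1 - expR (- x)) * (s x)^-1.
have sY : smooth Y by rewrite /Y; smoothness.
have Y0 : Y 0 = 0 by rewrite /Y oppr0 expR0 subrr mul0r.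
have Y'0 : derive1 Y 0 != 0.
  have dN : is_derive (0 : R) 1 (fun x : R => -1 * x) (-1 * 1).
    by apply: is_derive_scale; exact: is_derive_id.
  have dE := is_derive_comp (g := fun x : R => -1 * x) (is_derive_expR _) dN.
  have d1 := is_derive_sub (is_derive_cst (1 : R) (0 : R) (1 : R)) dE.
  have := derive1_val (is_derive_mul d1 (smooth_is_derive 0 sV)).
  have -> : (fun y : R => (cst 1 y - expR (-1 * y)) * (s y)^-1) = Y.
    by apply/funext => y; rewrite mulN1r.
  move=> ->; have st : s 0 = t by rewrite /s cutoff0 mulr0 subr0.
  rewrite (_ : _ + _ = t^-1) ?invr_eq0//= mulr0 expR0 st; ring.
have [D DE] := diffeo_extension sY Y0 Y'0.
have sw := @dinv_smooth R D.
have w0 : Defs.dinv D 0 = 0 by exact: dinv0.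
have cw : Defs.dinv D y @[y --> (0 : R)] --> 0.
  by have := smooth_continuous sw (x := 0); rewrite /continuous_at w0.
have ce := @cutoff_id R e e0.
exists (Defs.dinv D); split=> //.
  have DE' : \forall y \near (0 : R), D (Defs.dinv D y) = Y (Defs.dinv D y) by exact: (cw _ DE).
  have ce' : \forall y \near (0 : R), cutoff e (Defs.dinv D y) = Defs.dinv D y by exact: (cw _ ce).
  apply: filterS2 DE' ce' => y; rewrite dinvK => yE wE.
  have := s0 (Defs.dinv D y); move: yE; rewrite /Y /s wE.
  by move: (Defs.dinv D y) => W -> sW; rewrite divfK.
(* Near 0 the equation reads D(v(x)) = x^p, and D is injective on the line. *)
move=> v cv vE.
have Dv' : \forall x \near (0 : R), D (v x) = Y (v x) by exact: (cv _ DE).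
have cv' : \forall x \near (0 : R), cutoff e (v x) = v x by exact: (cv _ ce).
apply: filterS3 vE Dv' cv' => x vx Dv cvx.
rewrite -[LHS](dfunK D) Dv; congr (Defs.dinv D _).
rewrite /Y vx /s cvx mulfK//.
by have := s0 (v x); rewrite /s cvx.
Qed.

(** * Germs tangent to the identity in the flow of the normal form *)

Section Flow.
Variables (t : R) (w : R -> R).
Hypotheses (sw : smooth w) (w0 : w 0 = 0)
  (wE : \forall y \near (0 : R), 1 - expR (- w y) = y * (t - lam * w y)).

Let U y := expR (p%:R^-1 * w y).
Let f x := x * U (x ^+ p).

Let pn0 : p%:R != 0 :> R. Proof. by rewrite pnatr_eq0 -lt0n. Qed.

Let sU : smooth U. Proof. by rewrite /U; smoothness. Qed.

Let sf : smooth f.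
Proof.
have s : smooth (fun x => U (x ^+ p)).
  by apply: (smooth_comp_fun sU); smoothness.
by rewrite /f; smoothness.
Qed.

Let dexpN y : is_derive y 1 (fun y => expR (-1 * w y)) (expR (- w y) * - derive1 w y).
Proof.
have /is_derive_eq := is_derive_comp (g := fun y : R => -1 * w y) (is_derive_expR _)
  (is_derive_scale (-1) (smooth_is_derive y sw)); apply.
by rewrite !mulN1r.
Qed.

(** Implicit differentiation of [wE]. At 0 this gives w'(0) and, differentiated once more, w''(0);
    these determine the coefficients p + 1 and 2p + 1 of the flow. *)
Lemma flow_deriv : \forall y \near (0 : R),
  expR (- w y) * derive1 w y = t - lam * w y - lam * (y * derive1 w y).
Proof.
have := near_derive1 wE; apply: filterS => y.
have d1 := is_derive_sub (is_derive_cst (1 : R) y (1 : R)) (dexpN y).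
have := derive1_val d1.
have -> : (fun y : R => cst 1 y - expR (-1 * w y)) = (fun y => 1 - expR (- w y)).
  by apply/funext => z; rewrite mulN1r.
move=> ->.
have dlw := is_derive_scale lam (smooth_is_derive y sw).
have d2 := is_derive_mul (is_derive_id y (1 : R)) (is_derive_sub (is_derive_cst (t : R) y (1 : R)) dlw).
rewrite (derive1_val d2) /=.
by move=> H; apply: etrans (_ : _ = 0 - expR (- w y) * - derive1 w y) _; [ring|rewrite H; ring].
Qed.

Lemma flow_deriv0 : derive1 w 0 = t.
Proof.
have := nbhs_singleton flow_deriv.
by rewrite w0 oppr0 expR0 mul1r mul0r !mulr0 !subr0.
Qed.

Lemma flow_deriv20 : derive1 (derive1 w) 0 = t ^+ 2 - 2 * lam * t.
Proof.
have := nbhs_singleton (near_derive1 flow_deriv).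
have sw' := smooth_derive1 sw.
have d1 := is_derive_mul (dexpN 0) (smooth_is_derive 0 sw').
have := derive1_val d1.
have -> : (fun y : R => expR (-1 * w y) * derive1 w y) = (fun y => expR (- w y) * derive1 w y).
  by apply/funext => z; rewrite mulN1r.
move=> ->.
have dlw := is_derive_scale lam (smooth_is_derive 0 sw).
have d2 := is_derive_sub (is_derive_sub (is_derive_cst (t : R) 0 (1 : R)) dlw)
  (is_derive_scale lam (is_derive_mul (is_derive_id (0 : R) (1 : R)) (smooth_is_derive 0 sw'))).
rewrite (derive1_val d2) /= !mulN1r w0 oppr0 expR0 flow_deriv0 => H.
have := congr1 (fun z => z + t ^+ 2) H => {}H.
apply: etrans (_ : _ = 1 * - t * t + 1 * derive1 (derive1 w) 0 + t ^+ 2) _; first ring.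
by rewrite H; ring.
Qed.

Let dU y : is_derive y 1 U (U y * (p%:R^-1 * derive1 w y)).
Proof.
exact: (is_derive_comp (g := fun y : R => p%:R^-1 * w y) (is_derive_expR _)
  (is_derive_scale p%:R^-1 (smooth_is_derive y sw))).
Qed.

Let U0 : U 0 = 1. Proof. by rewrite /U w0 mulr0 expR0. Qed.

Let taylor_U1 : taylor_coef U 1 = t / p%:R.
Proof. by rewrite taylor_coef_idx1 (derive1_val (dU 0)) U0 flow_deriv0 mul1r mulrC. Qed.

Let taylor_U2 : taylor_coef U 2 =
  (t ^+ 2 - 2 * lam * t) / (2 * p%:R) + t ^+ 2 / (2 * p%:R ^+ 2).
Proof.
have E : derive1 U = fun y => U y * (p%:R^-1 * derive1 w y).
  by apply/funext => y; exact: derive1_val.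
rewrite /taylor_coef /= E.
have sw' := smooth_derive1 sw.
have d := is_derive_mul (dU 0) (is_derive_scale p%:R^-1 (smooth_is_derive 0 sw')).
rewrite (derive1_val d) U0 flow_deriv0 flow_deriv20 !factS fact0 !mul1r muln1.
by field.
Qed.

Let taylor_flow n : taylor_coef f n.+1 = if (p %| n)%N then taylor_coef U (n %/ p) else 0.
Proof.
have sX : smooth (fun x : R => x ^+ p) by smoothness.
have s : smooth (fun x => U (x ^+ p)) by exact: (smooth_comp_fun sU sX).
have X0 : (fun x : R => x ^+ p) 0 = 0 by rewrite expr0n (gtn_eqF p0).
rewrite -[LHS]/(taylor_coef (fun x => x ^+ 1 * U (x ^+ p)) n.+1) taylor_Xn_mul//= subn1 /=.
(* Truncation at n + p rather than n keeps the monomial x^p even when n < p. *)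
rewrite [LHS](taylor_comp n sU sX X0) (@fcompE _ _ (n + p)) ?leq_addr//; last first.
  by rewrite taylor_coef_idx0.
have -> : trunc (n + p) (taylor_coef (fun x : R => x ^+ p)) = 'X^p.
  have -> : (fun x : R => x ^+ p) = (fun x => ('X^p).[x]).
    by apply/funext => x; rewrite hornerXn.
  apply/polyP => i; rewrite coef_poly taylor_horner coefXn ltnS.
  case: leqP => // lt; rewrite gtn_eqF//.
  by apply: leq_ltn_trans lt; rewrite leq_addl.
rewrite coef_comp_poly_Xn//; case: ifP => // _.
by rewrite coef_trunc// (leq_trans (leq_div _ _))// leq_addr.
Qed.

Lemma near_pow (P : R -> Prop) :
  (\forall y \near (0 : R), P y) -> \forall x \near (0 : R), P (x ^+ p).
Proof.
move=> h; have : \forall x \near (0 : R), P (1 * x ^+ p) by exact: (monomial_cvg0 1 h).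
by apply: filterS => x; rewrite mul1r.
Qed.

Let derive1_f x : derive1 f x = U (x ^+ p) * (1 + x ^+ p * derive1 w (x ^+ p)).
Proof.
have d1 := is_derive_comp (g := fun x : R => x ^+ p) (dU (x ^+ p)) (is_derive_pow p x).
rewrite (derive1_val (is_derive_mul (is_derive_id x (1 : R)) d1)).
have E : x ^+ p.-1 * x = x ^+ p by rewrite -exprSr prednK.
transitivity (U (x ^+ p) * (1 + (x ^+ p.-1 * x) * derive1 w (x ^+ p))); last by rewrite E.
by move: (U _) (derive1 w _) (x ^+ p.-1) => u W' z /=; field.
Qed.

Let flow_julia : \forall x \near (0 : R), nf (f x) = derive1 f x * nf x.
Proof.
have f0 : f 0 = 0 by rewrite /f mul0r.
have cf := smooth_continuous sf (x := 0); rewrite /continuous_at f0 in cf.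
have nff : \forall x \near (0 : R), 0 < 1 + lam * f x ^+ p /\
    nf (f x) = f x ^+ p.+1 / (1 + lam * f x ^+ p) by exact: (cf _ nf_near).
have wEp := near_pow wE; have wDp := near_pow flow_deriv.
near=> x.
have [den nfx] : 0 < 1 + lam * x ^+ p /\ nf x = x ^+ p.+1 / (1 + lam * x ^+ p).
  by near: x; exact: nf_near.
have [denf nffx] : 0 < 1 + lam * f x ^+ p /\
    nf (f x) = f x ^+ p.+1 / (1 + lam * f x ^+ p) by near: x.
have hA : 1 - expR (- w (x ^+ p)) = x ^+ p * (t - lam * w (x ^+ p)) by near: x.
have hB : expR (- w (x ^+ p)) * derive1 w (x ^+ p) =
    t - lam * w (x ^+ p) - lam * (x ^+ p * derive1 w (x ^+ p)) by near: x.
have fp : f x ^+ p = x ^+ p * expR (w (x ^+ p)).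
  by rewrite /f exprMn /U -expRM_natl mulrA divff// mul1r.
have E0 := expR_gt0 (w (x ^+ p)).
rewrite derive1_f nffx nfx !exprS {1}/f.
move: denf; rewrite fp; move: hA hB den E0; rewrite expRN.
move: (x ^+ p) (w _) (derive1 w _) (U _) (expR (w _)) => y W W' u E hA hB den E0 denf.
have denf0 : 1 + lam * (y * E) != 0 by rewrite gt_eqF.
(* Multiplying [hB] by y and inserting [hA] eliminates t. With f^p = y E, the Julia equation becomes
   a rational identity. *)
have -> : y * W' = (E - 1) / (1 + lam * (y * E)).
  apply: (canRL (mulfK denf0)).
  have -> : y * W' * (1 + lam * (y * E)) = E * (y * (E^-1 * W') + lam * (y * (y * W'))).
    by field; rewrite gt_eqF.
  rewrite hB; transitivity (E * (y * (t - lam * W))); first ring.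
  by rewrite -hA; field; rewrite gt_eqF.
field; apply/andP; split; rewrite gt_eqF.
Unshelve. all: by end_near.
Qed.

Lemma flow_diffeo : exists d : diffeo R, [/\ \forall x \near (0 : R), d x = x * expR (p%:R^-1 * w (x ^+ p)),
   forall i, (i <= p.*2)%N -> taylor_coef d i = fid R i + (i == p.+1)%:R * (t / p%:R),
   taylor_coef d p.*2.+1 = (t ^+ 2 - 2 * lam * t) / (2 * p%:R) + t ^+ 2 / (2 * p%:R ^+ 2)
 & flat_eq (fun x => nf (d x)) (fun x => derive1 d x * nf x)].
Proof.
have f0 : f 0 = 0 by rewrite /f mul0r.
have tU0 : taylor_coef U 0 = 1 by rewrite taylor_coef_idx0.
have f1 : derive1 f 0 != 0.
  by rewrite -taylor_coef_idx1 taylor_flow dvdn0 div0n tU0 oner_neq0.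
have [d df] := diffeo_extension sf f0 f1.
have sd := @dfun_smooth R d; have sn := smooth_nf; have sd' := smooth_derive1 sd.
exists d; split.
- exact: df.
- move=> i; rewrite (near_taylor_coef df); case: i => [_|n ltn].
    by rewrite taylor_coef_idx0 f0 /fid mul0r addr0.
  rewrite taylor_flow eqSS /fid eqSS; have [->|n0] := eqVneq n 0%N.
    by rewrite dvdn0 div0n tU0 ltn_eqF// mul0r addr0.
  have [->|np] := eqVneq n p; first by rewrite dvdnn divnn p0 taylor_U1 mul1r add0r.
  rewrite ifF ?mul0r ?addr0//; apply/negP => /dvdnP[k nE].
  move: ltn n0 np; rewrite nE -mul2n ltn_pmul2r//.
  by case: k {nE} => [|[|k]]; rewrite ?mul0n ?mul1n ?eqxx.
- by rewrite (near_taylor_coef df) taylor_flow -muln2 dvdn_mulr// mulKn.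
- apply: flat_eq_near; [exact: smooth_comp_fun|exact: smooth_mul|].
  apply: filterS3 df (near_derive1 df) flow_julia => x -> ->.
  by [].
Qed.

End Flow.

(* In the coordinate -1/(p x^p) + lam log x, where nf is constant, such an f
   is the affine map of slope k^-p and translation t / p. *)
Definition flow_type k t (f : R -> R) := exists2 v : R -> R, v x @[x --> (0 : R)] --> 0
  & \forall x \near (0 : R), f x = k * x * expR (p%:R^-1 * v x) /\
      1 - expR (- v x) = x ^+ p * (t - lam * v x).

(** By [nf_rescale] below, x -> k x turns the residue lam into lam k^p; these are the k that
    preserve the normal form up to a constant factor. *)
Definition admissible k := k != 0 /\ (lam != 0 -> k ^+ p = 1).

Definition flow_group : set (germ_diffeo R) :=
  [set x : germ_diffeo R | exists k t, admissible k /\ flow_type k t (repr x : diffeo R)].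

Lemma flow_groupP k t (d : diffeo R) : admissible k -> flow_type k t d ->
  flow_group (germ_of d).
Proof.
move=> kA [v cv vE]; exists k, t; split=> //; exists v => //.
by apply: filterS2 (near_repr d) vE => x -> .
Qed.

Let pn0 : p%:R != 0 :> R. Proof. by rewrite pnatr_eq0 -lt0n. Qed.

Lemma admissible_lam k : admissible k -> lam * k ^+ p = lam.
Proof.
case=> _ h; have [->|/h->] := eqVneq lam 0; first by rewrite mul0r.
by rewrite mulr1.
Qed.

Lemma expR_root (v : R) : expR (p%:R^-1 * v) ^+ p = expR v.
Proof. by rewrite -expRM_natl mulrA divff// mul1r. Qed.

Lemma flow_linear k (d : diffeo R) : (forall x, d x = k * x) -> flow_type k 0 d.
Proof.
move=> dE; exists (fun=> 0); first exact: cvg_cst.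
by apply: filterE => x; rewrite dE oppr0 !mulr0 expR0 mulr1 !subrr mulr0.
Qed.

Lemma diffeo_cvg0 (d : diffeo R) : d x @[x --> (0 : R)] --> 0.
Proof.
by have := smooth_continuous (@dfun_smooth R d) (x := 0); rewrite /continuous_at dfun0.
Qed.

(** The logarithms v' and v o g add. The law for t follows from 1 - exp(-v'-v) = (1 - exp(-v')) +
    exp(-v')(1 - exp(-v)), together with g^p = k'^p x^p exp(v') and lam k'^p = lam. *)
Lemma flow_type_comp k t k' t' (f g : diffeo R) : admissible k' ->
  flow_type k t f -> flow_type k' t' g ->
  flow_type (k * k') (t' + k' ^+ p * t) (fun x => f (g x)).
Proof.
move=> kA [v cv vE] [v' cv' vE']; exists (fun x => v' x + v (g x)).
  rewrite -[X in _ --> X]addr0; apply: cvgD cv' _.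
  exact: cvg_comp (diffeo_cvg0 g) cv.
have vEg : \forall x \near (0 : R), f (g x) = k * g x * expR (p%:R^-1 * v (g x)) /\
  1 - expR (- v (g x)) = g x ^+ p * (t - lam * v (g x)) by exact: (diffeo_cvg0 g vE).
apply: filterS2 vEg vE' => x [fgx hg] [gx hx]; split.
  by rewrite fgx gx mulrDr expRD; ring.
rewrite opprD expRD.
have gp : g x ^+ p = k' ^+ p * (x ^+ p * expR (v' x)).
  by rewrite gx !exprMn expR_root mulrA.
have lk := admissible_lam kA.
move: hg hx; rewrite gp !expRN => hg hx; have E0 := expR_gt0 (v' x).
rewrite (_ : 1 - _ = (1 - (expR (v' x))^-1) +
  (expR (v' x))^-1 * (1 - (expR (v (g x)))^-1)); last by ring.
rewrite hg hx.
rewrite (_ : _ * (k' ^+ p * _ * _) = x ^+ p * (k' ^+ p * t - (lam * k' ^+ p) * v (g x))).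
  by rewrite lk; ring.
by field; rewrite gt_eqF.
Qed.

Lemma flow_type_inv k t (f : diffeo R) : admissible k -> flow_type k t f ->
  flow_type k^-1 (- (t / k ^+ p)) (diffeo_inv f).
Proof.
move=> kA [v cv vE]; have [k0 _] := kA; have kp0 : k ^+ p != 0 by rewrite expf_neq0.
have c0 := diffeo_cvg0 (diffeo_inv f).
exists (fun y => - v (diffeo_inv f y)).
  by rewrite -[X in _ --> X]oppr0; apply: cvgN; exact: cvg_comp c0 cv.
have vEi : \forall y \near (0 : R), f (diffeo_inv f y) = k * diffeo_inv f y *
    expR (p%:R^-1 * v (diffeo_inv f y)) /\
  1 - expR (- v (diffeo_inv f y)) = diffeo_inv f y ^+ p * (t - lam * v (diffeo_inv f y)).
  exact: (c0 _ vE).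
apply: filterS vEi => y; rewrite [f (diffeo_inv f y)]dinvK.
move: (diffeo_inv f y) => x [yE hx]; have E0 := expR_gt0 (p%:R^-1 * v x).
have En0 : expR (p%:R^-1 * v x) != 0 by rewrite gt_eqF.
split; first by rewrite mulrN expRN yE; field; rewrite En0.
have lk := admissible_lam kA.
have yp : y ^+ p = k ^+ p * (x ^+ p * expR (v x)).
  by rewrite yE !exprMn expR_root mulrA.
have Ev0 : expR (v x) != 0 by rewrite gt_eqF ?expR_gt0.
rewrite opprK yp; move: hx; rewrite expRN => hx.
rewrite (_ : 1 - _ = - expR (v x) * (1 - (expR (v x))^-1)); last by field.
rewrite hx.
rewrite (_ : _ * (- (_ / _) - _) = x ^+ p * expR (v x) *
   - (t - lam * k ^+ p * v x)); last by field.
by rewrite lk; ring.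
Qed.

Lemma admissibleM k k' : admissible k -> admissible k' -> admissible (k * k').
Proof.
move=> [k0 kp] [k'0 k'p]; split; first by rewrite mulf_neq0.
by move=> l; rewrite exprMn kp// k'p// mul1r.
Qed.

Lemma flow_group_subgroup : is_subgroup flow_group.
Proof.
have A1 : admissible 1 by split; rewrite ?oner_neq0// expr1n.
split.
- apply: (@flow_groupP 1 0 _ A1); apply: flow_linear => x /=.
  by rewrite mul1r.
- elim/germ_ind => f; elim/germ_ind => g; rewrite [(_ * _)%g]germ_mulE.
  rewrite /flow_group /= => -[k [t [kA kf]]] [k' [t' [kA' kg]]].
  have near_type l s (d : diffeo R) : flow_type l s (repr (germ_of d)) -> flow_type l s d.
    move=> [v cv vE]; exists v => //.
    by apply: filterS2 (near_repr d) vE => x ->.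
  apply: (@flow_groupP _ _ (diffeo_mul f g) (admissibleM kA kA')).
  exact: (flow_type_comp kA' (near_type _ _ _ kf) (near_type _ _ _ kg)).
elim/germ_ind => f; rewrite [(_^-1)%g]germ_invE => -[k [t [kA [v cv vE]]]].
have kA' : admissible k^-1.
  by case: kA => k0 kp; split; [rewrite invr_eq0|move=> l; rewrite exprVn kp// invr1].
have tf : flow_type k t f.
  by exists v => //; apply: filterS2 (near_repr f) vE => x ->.
exact: (@flow_groupP _ _ (diffeo_inv f) kA' (flow_type_inv kA tf)).
Qed.

(** For t = 0 the equation is 1 - exp(-v) = - lam x^p v; this lower bound then forces v = 0 for
    small x. *)
Lemma expRN_lower (v : R) : `|v| <= 1 -> `|v| / 2 <= `|1 - expR (- v)|.
Proof.
move=> v1; have [v0|v0] := leP 0 v.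
  rewrite ger0_norm//; rewrite ger0_norm// in v1.
  have h := expR_ge1Dx v; have h0 := expR_gt0 v.
  apply: le_trans (ler_norm _); rewrite expRN.
  rewrite -(ler_pM2r h0) mulrBl mul1r mulVf ?gt_eqF//.
  have e2 : expR v * (1 - v) <= 1.
    rewrite -ler_pdivlMl// mulr1 -expRN; exact: expR_ge1Dx.
  nra.
rewrite distrC; apply: le_trans (ler_norm _).
have := expR_ge1Dx (- v); rewrite ltr0_norm//; lra.
Qed.

(** If t = 0 the germ is linear, hence determined by its multiplier. Otherwise [v] is the function
    built in [flow_exists], and the coefficient of index p + 1 is k t / p, which is not 0. *)
Lemma flow_group_inj (g : germ_diffeo R) : flow_group g -> taylor g = 1%g -> g = 1%g.
Proof.
elim/germ_ind: g => d [k [t [kA [v cv vE]]]] td.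
have {}vE : \forall x \near (0 : R), d x = k * x * expR (p%:R^-1 * v x) /\
      1 - expR (- v x) = x ^+ p * (t - lam * v x).
  by apply: filterS2 (near_repr d) vE => x ->.
have tdE n : taylor_coef d n = fid R n.
  by rewrite -taylorE td.
have linear : (\forall x \near (0 : R), d x = k * x) -> germ_of d = 1%g.
  move=> dk; suff k1 : k = 1.
    by apply/eqP/germP; apply: filterS dk => x -> /=; rewrite k1 mul1r.
  have := tdE 1%N; rewrite (near_taylor_coef dk) taylor_scale ?taylor_id.
    by rewrite /fid eqxx mulr1.
  exact: smooth_var.
have [t0|tn0] := eqVneq t 0.
  apply: linear.
  have v1 : \forall x \near (0 : R), `|v x| <= 1.
    have := cv; move=> /cvgrPdist_le/(_ 1 ltr01); apply: filterS => x.
    by rewrite sub0r normrN.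
  have e0 : 0 < 4^-1 :> R by rewrite invr_gt0.
  have xs : \forall x \near (0 : R), `|lam * x ^+ p| <= 4^-1.
    have := monomial_cvg0 lam; move=> /cvgrPdist_le/(_ _ e0); apply: filterS => x.
    by rewrite sub0r normrN.
  apply: filterS3 vE v1 xs => x [-> hx] vx1 xsx.
  suff -> : v x = 0 by rewrite mulr0 expR0 mulr1.
  have := expRN_lower vx1; rewrite hx t0 sub0r mulrN normrN mulrA [x ^+ p * lam]mulrC normrM.
  move=> h; apply/eqP; rewrite -normr_le0.
  have := ler_wpM2r (normr_ge0 (v x)) xsx; lra.
have [w [sw w0 wE wU]] := flow_exists tn0.
have [d1 [d1E d1lt _ _]] := flow_diffeo sw w0 wE.
have dd1 : \forall x \near (0 : R), d x = k * d1 x.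
  have vw : \forall x \near (0 : R), v x = w (x ^+ p).
    by apply: wU cv _; apply: filterS vE => x [].
  by apply: filterS3 vE vw d1E => x [-> _] -> ->; rewrite mulrA.
have p2 : (p.+1 <= p.*2)%N by rewrite -addnn -addn1 leq_add2l.
have := tdE p.+1; rewrite (near_taylor_coef dd1) taylor_scale; last exact: dfun_smooth.
rewrite d1lt// /fid eqSS (gtn_eqF p0) eqxx mul1r add0r => /eqP.
rewrite !mulf_eq0 invr_eq0 (negbTE pn0) (negbTE tn0).
by case: kA => /negbTE->.
Qed.

End NormalForm.

(** * The normalizer of a vector field in normal form *)

Section Normalizer.
Variables (R : realType) (p : nat) (p0 : (0 < p)%N).
Implicit Types (lam k t : R) (f a b d r : diffeo R).

Local Notation sm d := (@dfun_smooth R d).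

Lemma derive1_dinv f x : derive1 (Defs.dinv f) (f x) * derive1 f x = 1.
Proof.
rewrite -(derive1_comp_fun x (@dinv_smooth R f) (sm f)).
rewrite (_ : (fun x => _) = id) ?derive1_id//.
by apply/funext => y; rewrite dfunK.
Qed.

Lemma derive1_neq0 f x : derive1 f x != 0.
Proof.
by apply/eqP => h; have := derive1_dinv f x; rewrite h mulr0 => /esym/eqP; rewrite oner_eq0.
Qed.

(* M is the pull-back of the vector field N by f. *)
Lemma julia_pullback (N : R -> R) f a b : smooth N ->
  flat_eq (fun x => b (f x)) (fun x => f (a x)) ->
  flat_eq (fun x => N (b x)) (fun x => derive1 b x * N x) ->
  let M x := derive1 (Defs.dinv f) (f x) * N (f x) in
  flat_eq (fun x => M (a x)) (fun x => derive1 a x * M x).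
Proof.
move=> sN bf Nb M.
have si' := smooth_derive1 (@dinv_smooth R f).
pose kap x := derive1 (Defs.dinv f) (f x).
have skap : smooth kap := smooth_comp_fun si' (sm f).
have skapa : smooth (fun x => kap (a x)) := smooth_comp_fun skap (sm a).
have sNf : smooth (fun x => N (f x)) := smooth_comp_fun sN (sm f).
have E1 : flat_eq (fun x => N (f (a x))) (fun x => N (b (f x))).
  apply: (flat_eq_comp (flat_eq_refl sN) (flat_eq_sym bf)).
  by rewrite !dfun0.
have E2 : flat_eq (fun x => N (b (f x))) (fun x => derive1 b (f x) * N (f x)).
  exact: (flat_eq_comp Nb (flat_eq_refl (sm f)) (dfun0 f)).
have E3 := flat_eq_derive bf.
rewrite (_ : derive1 (fun x => b (f x)) = fun x => derive1 b (f x) * derive1 f x) in E3;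
  last by apply/funext => x; exact: (derive1_comp_fun x (sm b) (sm f)).
rewrite (_ : derive1 (fun x => f (a x)) = fun x => derive1 f (a x) * derive1 a x) in E3;
  last by apply/funext => x; exact: (derive1_comp_fun x (sm f) (sm a)).
have E4 := flat_eqM (flat_eq_refl skapa) (flat_eq_trans E1 E2).
(* Multiplied by this factor, the differentiated conjugacy [E3] becomes the wanted identity, as
   [kap] is the reciprocal of f'. *)
have sK : smooth (fun x => kap x * kap (a x) * N (f x)) :=
  smooth_mul (smooth_mul skap skapa) sNf.
have E5 := flat_eqM E3 (flat_eq_refl sK).
rewrite (_ : (fun x => derive1 b (f x) * derive1 f x * (kap x * kap (a x) * N (f x))) =
  fun x => kap (a x) * (derive1 b (f x) * N (f x))) in E5; last first.
  apply/funext => x; have := derive1_dinv f x; rewrite -/(kap x) => h.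
  transitivity ((kap x * derive1 f x) * (kap (a x) * (derive1 b (f x) * N (f x)))); first ring.
  by rewrite h mul1r.
rewrite (_ : (fun x => derive1 f (a x) * derive1 a x * (kap x * kap (a x) * N (f x))) =
  fun x => derive1 a x * M x) in E5; last first.
  apply/funext => x; have := derive1_dinv f (a x); rewrite -/(kap (a x)) => h.
  transitivity ((kap (a x) * derive1 f (a x)) * (derive1 a x * (kap x * N (f x)))); first ring.
  by rewrite h mul1r.
exact: flat_eq_trans E4 E5.
Qed.

Let snf lam : smooth (nf p lam) := @smooth_nf R p lam.

(** The coefficients of index p + 1 give f'(0)^(p+1) = c f'(0). *)
Lemma nf_multiplier lam f c :
  flat_eq (fun x => nf p lam (f x)) (fun x => c * (derive1 f x * nf p lam x)) ->
  c = derive1 f 0 ^+ p.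
Proof.
have sf' := smooth_derive1 (sm f).
have sfn : smooth (fun x => derive1 f x * nf p lam x) := smooth_mul sf' (@snf lam).
have lt i : (i < p.+1)%N -> taylor_coef (nf p lam) i = 0 by exact: taylor_nf_lt.
case=> _ _ /(congr1 (fun u => u p.+1)) /=.
rewrite (@taylor_comp_lead _ (nf p lam) f p.+1 (@snf lam) (sm f) (dfun0 f) lt).
rewrite (taylor_scale _ _ sfn) (@taylor_mul_lead _ (derive1 f) _ _ sf' (@snf lam) lt).
rewrite (taylor_nf_lead p0 lam).
rewrite mul1r mulr1 exprSr => h; apply: (mulIf (derive1_neq0 f 0)).
by rewrite -h.
Qed.

(** The pull-back of [nf] by f and [nf] itself solve the Julia equation of a, hence are
    proportional. *)
Lemma nf_normalizer lam a b f :
  flat_eq (fun x => nf p lam (a x)) (fun x => derive1 a x * nf p lam x) ->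
  tangent_id p a -> taylor_coef a p.+1 != 0 ->
  flat_eq (fun x => b (f x)) (fun x => f (a x)) ->
  flat_eq (fun x => nf p lam (b x)) (fun x => derive1 b x * nf p lam x) ->
  flat_eq (fun x => nf p lam (f x))
    (fun x => derive1 f 0 ^+ p * (derive1 f x * nf p lam x)).
Proof.
move=> Ja ta a1 bf Jb; have := julia_pullback (@snf lam) bf Jb => /=.
have sf' := smooth_derive1 (sm f).
have skap := smooth_comp_fun (smooth_derive1 (@dinv_smooth R f)) (sm f).
have sNf : smooth (fun x => nf p lam (f x)) := smooth_comp_fun (@snf lam) (sm f).
set M := fun x => derive1 (Defs.dinv f) (f x) * nf p lam (f x) => JM.
have sM : smooth M by exact: smooth_mul.
have [|||c Mc] := julia_unique JM Ja sM (@snf lam) (sm a) p0 ta a1.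
- by rewrite /M dfun0 nf0 mulr0.
- by rewrite nf0.
- by rewrite taylor_nf_lead// oner_neq0.
have := flat_eqM (flat_eq_refl sf') Mc.
rewrite (_ : (fun x => derive1 f x * M x) = fun x => nf p lam (f x)); last first.
  by apply/funext => x; rewrite /M mulrA [_ * derive1 (Defs.dinv f) _]mulrC derive1_dinv mul1r.
rewrite (_ : (fun x => derive1 f x * (c * nf p lam x)) =
    fun x => c * (derive1 f x * nf p lam x)); last by apply/funext => x; rewrite mulrCA.
by move=> H; rewrite -(nf_multiplier H).
Qed.

(** A commutation is a conjugacy of a to itself by b, and the constant factor is 1 because b is
    tangent to the identity. *)
Lemma nf_centralizer lam a b :
  flat_eq (fun x => nf p lam (a x)) (fun x => derive1 a x * nf p lam x) ->
  tangent_id p a -> taylor_coef a p.+1 != 0 -> derive1 b 0 = 1 ->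
  flat_eq (fun x => a (b x)) (fun x => b (a x)) ->
  flat_eq (fun x => nf p lam (b x)) (fun x => derive1 b x * nf p lam x).
Proof.
move=> Ja ta a1 b1 ab; have := nf_normalizer Ja ta a1 ab Ja.
by rewrite b1 expr1n; under [X in flat_eq _ X]eq_fun do rewrite mul1r.
Qed.

Lemma nf_rescale lam k : flat_eq (fun y => nf p lam (k * y))
  (fun y => k ^+ p.+1 * nf p (lam * k ^+ p) y).
Proof.
have sk : smooth (fun y : R => k * y) by smoothness.
have sl := @snf lam; have slk := @snf (lam * k ^+ p).
apply: (flat_eq_near (smooth_comp_fun sl sk) (smooth_mul (@smooth_cst _ _) slk)).
have ck : k * y @[y --> (0 : R)] --> 0.
  by have := smooth_continuous sk (x := 0); rewrite /continuous_at mulr0.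
have h : \forall y \near (0 : R), 0 < 1 + lam * (k * y) ^+ p /\
   nf p lam (k * y) = (k * y) ^+ p.+1 / (1 + lam * (k * y) ^+ p).
  exact: (ck _ (nf_near p0 lam)).
apply: filterS2 h (nf_near p0 (lam * k ^+ p)) => y [_ ->] [_ ->].
by rewrite !exprMn mulrA mulrA.
Qed.

Lemma taylor_nf_diff lam l' : smooth (fun x => nf p lam x - nf p l' x) /\
  forall n, (n <= p.*2.+1)%N ->
  taylor_coef (fun x => nf p lam x - nf p l' x) n = (n == p.*2.+1)%:R * (l' - lam).
Proof.
have sl := @snf lam; have sl' := @snf l'.
split; first exact: smooth_sub.
have u := @smooth_nf_unit R p lam; have u' := @smooth_nf_unit R p l'.
pose g x := (l' - lam) * (nf_unit p lam x * nf_unit p l' x).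
have sg : smooth g by rewrite /g; smoothness.
move=> n len; rewrite (@near_taylor_coef _ _ (fun x => x ^+ p.*2.+1 * g x)); last first.
  apply: filterS2 (nf_unit_near p0 lam) (nf_unit_near p0 l') => x [h1 e1] [h2 e2].
  rewrite /nf /g e1 e2 -addnn -addnS exprD.
  by field; rewrite !gt_eqF.
rewrite taylor_Xn_mul//; move: len; rewrite leq_eqVlt => /predU1P[->|ltn].
  by rewrite ltnn eqxx subnn taylor_coef_idx0 /g !nf_unit0// !mulr1 mul1r.
by rewrite ltn (ltn_eqF ltn) mul0r.
Qed.

(* lam is the residue of the form dual to nf. *)
Lemma nf_residue lam l' r : derive1 r 0 = 1 ->
  flat_eq (fun x => nf p l' (r x)) (fun x => derive1 r x * nf p lam x) -> l' = lam.
Proof.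
move=> r1 J; have [sd dE] := taylor_nf_diff lam l'.
have sr' := smooth_derive1 (sm r); have sl := @snf lam; have sl' := @snf l'.
have sN : smooth (fun x => derive1 r x * nf p l' x) by exact: smooth_mul.
have := flat_eqB J (flat_eq_refl sN).
rewrite (_ : (fun x => derive1 r x * nf p lam x - derive1 r x * nf p l' x) =
  fun x => derive1 r x * (nf p lam x - nf p l' x)); last first.
  by apply/funext => x; rewrite mulrBr.
case=> _ _ /(congr1 (fun u => u p.*2.+1)); rewrite [RHS]taylor_mul_lead//; last first.
  by move=> i ip; rewrite dE ?(ltnW ip)// (ltn_eqF ip) mul0r.
rewrite dE// eqxx !mul1r r1 mul1r => E; apply/eqP; rewrite -subr_eq0 -E; apply/eqP.
have lt i : (i < p.+1)%N -> taylor_coef (nf p l') i = 0 by exact: taylor_nf_lt.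
have [tr|tr] := EM (taylor_coef r = fid R).
  have ri : flat_eq r (fun x => x).
    split; [exact: dfun_smooth|exact: smooth_var|].
    by rewrite tr; apply/funext => n; rewrite taylor_id.
  have := flat_eqB (flat_eq_comp (flat_eq_refl sl') ri (dfun0 r))
     (flat_eqM (flat_eq_derive ri) (flat_eq_refl sl')).
  case=> _ _ ->.
  rewrite (_ : (fun x : R => nf p l' x - derive1 (fun x : R => x) x * nf p l' x) = fun=> 0) ?taylor_cst ?mul0r//.
  by apply/funext => x; rewrite derive1_id mul1r subrr.
have [q [q0 tq rq]] := tangent_index (dfun0 r) r1 tr.
have [Jlt Jeq] := julia_coef sl' (sm r) q0 tq (ltn0Sn p) lt.
(* The Julia operator of r sends [nf p l'] to a function of order at least 2p + 1, with coefficient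
   l' - lam there. For q >= p that coefficient is 0, at q = p by the resonance; q < p would give a
   nonzero coefficient at q + p + 1 < 2p + 1. *)
have [qp|pq|qp] := ltngtP q p; last 2 first.
- by apply: Jlt; rewrite -addnn -addnS ltn_add2r.
- by move: Jeq; rewrite qp addnS addnn => ->; rewrite subrr !mul0r.
have := flat_eqB J (flat_eq_refl sN).
rewrite (_ : (fun x => derive1 r x * nf p lam x - derive1 r x * nf p l' x) =
  fun x => derive1 r x * (nf p lam x - nf p l' x)); last first.
  by apply/funext => x; rewrite mulrBr.
have qlt : (q + p.+1 < p.*2.+1)%N by rewrite -addnn -[(p + p).+1]addnS ltn_add2r.
case=> _ _ /(congr1 (fun u => u (q + p.+1)%N)); rewrite Jeq (@taylor_mul_lead _ (derive1 r))//; last first.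
  move=> i ip; have ip' := ltn_trans ip qlt.
  by rewrite dE ?(ltnW ip')// (ltn_eqF ip') mul0r.
rewrite dE ?(ltnW qlt)// (ltn_eqF qlt) mul0r mulr0 taylor_nf_lead// mulr1 => /eqP.
by rewrite mulf_eq0 (negbTE rq) orbF subr_eq0 eqr_nat eqSS gtn_eqF.
Qed.

(** * Diffeomorphisms that preserve the normal form *)

Definition nf_fixed lam d :=
  flat_eq (fun x => nf p lam (d x)) (fun x => derive1 d x * nf p lam x).

Lemma nf_fixed_inv lam d : nf_fixed lam d -> nf_fixed lam (diffeo_inv d).
Proof.
move=> J; have si := @dinv_smooth R d; have si' := smooth_derive1 si.
have h0 : Defs.dinv d 0 = 0 := dinv0 d.
have := flat_eqM (flat_eq_refl si') (flat_eq_comp J (flat_eq_refl si) h0).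
rewrite (_ : (fun x => _ * nf p lam (d _)) = fun x => derive1 (Defs.dinv d) x * nf p lam x);
  last by apply/funext => x; rewrite dinvK.
rewrite (_ : (fun x => _ * (_ * nf p lam _)) = fun x => nf p lam (Defs.dinv d x)).
  exact: flat_eq_sym.
apply/funext => x; have := derive1_dinv d (Defs.dinv d x); rewrite dinvK => h.
by rewrite mulrA h mul1r.
Qed.

Lemma nf_fixedM lam d r : nf_fixed lam d -> nf_fixed lam r -> nf_fixed lam (diffeo_mul d r).
Proof.
move=> Jd Jr; have sd' := smooth_derive1 (sm d).
have sdr := smooth_comp_fun sd' (sm r).
rewrite /nf_fixed (_ : (fun x => derive1 (diffeo_mul d r) x * nf p lam x) =
  fun x => derive1 d (r x) * (derive1 r x * nf p lam x)); last first.
  apply/funext => x; rewrite mulrA; congr (_ * _).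
  exact: (derive1_comp_fun x (sm d) (sm r)).
apply: flat_eq_trans (flat_eqM (flat_eq_refl sdr) Jr).
exact: (flat_eq_comp Jd (flat_eq_refl (sm r)) (dfun0 r)).
Qed.

Lemma nf_fixed_tangent lam r : derive1 r 0 = 1 -> nf_fixed lam r ->
  taylor_coef r <> fid R -> tangent_id p r /\ taylor_coef r p.+1 != 0.
Proof.
move=> r1 J tr; have [q [q0 tq rq]] := tangent_index (dfun0 r) r1 tr.
have lt i : (i < p.+1)%N -> taylor_coef (nf p lam) i = 0 by exact: taylor_nf_lt.
have := julia_order J (@snf lam) (sm r) q0 tq rq (ltn0Sn p) lt.
by rewrite taylor_nf_lead// => /(_ (oner_neq0 _))[->].
Qed.

Let pn0 : p%:R != 0 :> R. Proof. by rewrite pnatr_eq0 -lt0n. Qed.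

Lemma nf_flow lam t : t != 0 -> exists d, [/\ flow_type p lam 1 t d, nf_fixed lam d,
  forall i, (i <= p.*2)%N -> taylor_coef d i = fid R i + (i == p.+1)%:R * (t / p%:R)
  & taylor_coef d p.*2.+1 = (t ^+ 2 - 2 * lam * t) / (2 * p%:R) + t ^+ 2 / (2 * p%:R ^+ 2)].
Proof.
move=> t0; have [w [sw w0 wE _]] := flow_exists p lam t0.
have [d [dE dlt d2 J]] := flow_diffeo p0 sw w0 wE.
exists d; split; [|exact: J|exact: dlt|exact: d2].
have sX : smooth (fun x : R => x ^+ p) by smoothness.
exists (fun x => w (x ^+ p)).
  have := smooth_continuous (smooth_comp_fun sw sX) (x := 0).
  by rewrite /continuous_at expr0n (gtn_eqF p0) w0.
by apply: filterS2 dE (near_pow p0 wE) => x -> h; rewrite mul1r.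
Qed.

(** Choose the flow d with the same coefficient of index p + 1 as r. Then s = d^-1 r also preserves
    [nf] and has no term of index p + 1, so by [nf_fixed_tangent] it is formally the identity. *)
Lemma nf_fixed_flow lam r : derive1 r 0 = 1 -> nf_fixed lam r ->
  exists t d, flow_type p lam 1 t d /\ taylor_coef r = taylor_coef d.
Proof.
move=> r1 J; have [tr|tr] := EM (taylor_coef r = fid R).
  exists 0, (diffeo_one R); split; first by apply: flow_linear => x; rewrite mul1r.
  by rewrite tr; apply/funext => n; rewrite taylor_id.
have [tp rp] := nf_fixed_tangent r1 J tr.
have t0 : p%:R * taylor_coef r p.+1 != 0 by rewrite mulf_neq0// pn0.
have [d [df Jd dlt _]] := nf_flow lam t0.
exists (p%:R * taylor_coef r p.+1), d; split=> //.
have dp : taylor_coef d p.+1 = taylor_coef r p.+1.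
  rewrite dlt; last by rewrite -addnn -addn1 leq_add2l.
  by rewrite eqxx mul1r /fid eqSS (gtn_eqF p0) add0r mulrC mulKf// pn0.
have d1 : derive1 d 0 = 1.
  rewrite -taylor_coef_idx1 dlt ?double_gt0// eqSS (ltn_eqF p0) mul0r addr0.
  by rewrite /fid eqxx.
pose s := diffeo_mul (diffeo_inv d) r.
have Js : nf_fixed lam s := nf_fixedM (nf_fixed_inv Jd) J.
have rE : (r : R -> R) = fun x => d (s x) by apply/funext => x; rewrite /= dinvK.
have s1 : derive1 s 0 = 1.
  have : derive1 (fun x => d (s x)) 0 = 1 by rewrite -rE.
  by rewrite derive1_comp_fun ?dfun0 ?d1 ?mul1r//; exact: dfun_smooth.
have [ts|ts] := EM (taylor_coef s = fid R).
  rewrite rE; apply/funext => n.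
  by rewrite [LHS](taylor_comp n (sm d) (sm s) (dfun0 s)) ts fcompf1.
have [tsp sp] := nf_fixed_tangent s1 Js ts.
have td0 i : (i <= 0)%N -> taylor_coef d i = 0.
  by rewrite leqn0 => /eqP->; rewrite taylor_coef_idx0 dfun0.
have [|_] := @fcomp_perturb R (taylor_coef d) (fid R) (taylor_coef s) 0 p.-1 td0 erefl.
  by move=> i; rewrite prednK//; exact: tsp.
rewrite addn0 prednK// -(taylor_comp p.+1 (sm d) (sm s) (dfun0 s)) -[d \o s]/(fun x => d (s x)) -rE.
rewrite fcompf1 dp taylor_coef_idx1 d1 expr0 !mulr1 mul1r /fid eqSS (gtn_eqF p0) subr0.
by move=> /eqP; rewrite addrC -subr_eq subrr eq_sym (negbTE sp).
Qed.

Lemma diffeo_linear k : k != 0 -> exists d, forall x, d x = k * x.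
Proof.
move=> k0.
have s1 : smooth (fun x : R => k * x) by smoothness.
have s2 : smooth (fun x : R => k^-1 * x) by smoothness.
by exists (Diffeo s1 s2 (mulKf k0) (mulVKf k0) (mulr0 k)).
Qed.

(** Write f = k r with r tangent to the identity. Then r relates the normal forms of residues lam
    k^p and lam, so these are equal, k is admissible, and r has the expansion of a flow. *)
Theorem flow_realize lam a b f : nf_fixed lam a ->
  tangent_id p a -> taylor_coef a p.+1 != 0 -> derive1 b 0 = 1 ->
  flat_eq (fun x => a (b x)) (fun x => b (a x)) ->
  flat_eq (fun x => b (f x)) (fun x => f (a x)) ->
  exists2 g, flow_group p lam g & taylor g = taylor (germ_of f).
Proof.
move=> Ja ta a1 b1 ab bf; have Jb := nf_centralizer Ja ta a1 b1 ab.
have Jf := nf_normalizer Ja ta a1 bf Jb.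
set k := derive1 f 0 in Jf; have k0 : k != 0 by exact: derive1_neq0.
have [ki kiE] := diffeo_linear (invr_neq0 k0); have [kd kdE] := diffeo_linear k0.
pose r := diffeo_mul ki f.
have rE x : r x = k^-1 * f x by rewrite /= kiE.
have fE x : f x = k * r x by rewrite rE mulVKf.
have r'E x : derive1 r x = k^-1 * derive1 f x.
  rewrite (_ : dfun r = fun x => k^-1 * f x); last by apply/funext => y; exact: rE.
  exact: derive1_val (is_derive_scale _ (smooth_is_derive x (sm f))).
have r1 : derive1 r 0 = 1 by rewrite r'E mulVf.
have Jr : flat_eq (fun x => nf p (lam * k ^+ p) (r x)) (fun x => derive1 r x * nf p lam x).
  have E1 := flat_eq_comp (nf_rescale lam k) (flat_eq_refl (sm r)) (dfun0 r).
  rewrite (_ : (fun x => nf p lam _) = fun x => nf p lam (f x)) in E1; last first.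
    by apply/funext => x; rewrite fE.
  have := flat_eq_scale (k ^- p.+1) (flat_eq_trans (flat_eq_sym E1) Jf).
  have kp : k ^+ p.+1 != 0 by rewrite expf_neq0.
  rewrite (_ : (fun x => _ * (_ * nf p (_ * _) _)) = fun x => nf p (lam * k ^+ p) (r x)); last first.
    by apply/funext => x; rewrite mulKf.
  rewrite (_ : (fun x => _ * (_ * (_ * nf p lam x))) = fun x => derive1 r x * nf p lam x)//.
  apply/funext => x; rewrite r'E exprSr; field.
  by rewrite k0 expf_neq0.
have lk := nf_residue r1 Jr.
have kA : admissible p lam k.
  split=> // l0; apply: (mulfI l0); by rewrite lk mulr1.
have Jr' : nf_fixed lam r by rewrite lk in Jr.
have [t [d [df rd]]] := nf_fixed_flow r1 Jr'.
exists (germ_of (diffeo_mul kd d)).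
  apply: (flow_groupP kA); first last.
    have A1 : admissible p lam 1 by split; rewrite ?oner_neq0// expr1n.
    have := flow_type_comp p0 A1 (flow_linear p lam kdE) df.
    by rewrite mulr1; exact.
apply: formal_diffeoP => n; rewrite !taylorE.
have dk : flat_eq (fun x => kd (d x)) (fun x => kd (r x)).
  apply: flat_eq_comp (flat_eq_refl (sm kd)) _ (dfun0 d).
  by split; [exact: dfun_smooth|exact: dfun_smooth|rewrite rd].
case: dk => _ _ /(congr1 (fun u => u n)) h; apply: etrans h _.
by congr (taylor_coef _ n); apply/funext => x; rewrite kdE -fE.
Qed.

End Normalizer.

(** * Solvable groups *)

Section Subgroups.
Local Open Scope group_scope.
Variable gT : groupType.
Implicit Types (A H K : set gT) (x y z : gT).

Lemma generated_subgroup A : is_subgroup (generated A).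
Proof.
split=> [H [] // |x y Ax Ay H sH AH|x Ax H sH AH].
  by have [_ hM _] := sH; apply: (hM); [exact: Ax|exact: Ay].
by have [_ _ hV] := sH; apply: hV; exact: Ax.
Qed.

Lemma sub_generated A : A `<=` generated A.
Proof. by move=> x Ax H _; exact. Qed.

Lemma derived_sub H : is_subgroup H -> derived H `<=` H.
Proof.
move=> sH x; apply=> // _ [y Hy [z Hz <-]]; have [_ hM hV] := sH.
by rewrite commgEl conjgE; exact: (hM _ _ (hV _ Hy) (hM _ _ (hV _ Hz) (hM _ _ Hy Hz))).
Qed.

Lemma iter_derived_subgroup H n : is_subgroup H -> is_subgroup (iter n (@derived gT) H).
Proof. by case: n => // n _; exact: generated_subgroup. Qed.

Lemma iter_derived_normal H n x g : is_subgroup H -> H g ->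
  iter n (@derived gT) H x -> iter n (@derived gT) H (x ^ g).
Proof.
move=> sH Hg; elim: n x => [|n IH] x.
  move=> Hx; have [_ hM hV] := sH; rewrite conjgE.
  exact: (hM _ _ (hV _ Hg) (hM _ _ Hx Hg)).
rewrite iterS => dx; set D := derived _.
have [D1 DM DV] : is_subgroup D := generated_subgroup _.
apply: (dx [set y | D (y ^ g)]).
  split=> /=; first by rewrite conj1g.
    by move=> y z Dy Dz; rewrite conjMg; exact: DM.
  by move=> y Dy; rewrite conjVg; exact: DV.
move=> _ [y Hy [z Hz <-]] /=; rewrite conjRg; apply: sub_generated.
by exists (y ^ g); [exact: IH|exists (z ^ g) => //; exact: IH].
Qed.

Lemma derived1_commute H x y : derived H = [set 1] -> H x -> H y -> commute x y.
Proof.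
move=> H1 Hx Hy; have : derived H [~ x, y] by apply: sub_generated; exists x => //; exists y.
by rewrite H1 /= => /eqP/commgP.
Qed.

(* K is the last nontrivial term of the derived series. *)
Lemma solvable_abelian_normal H : solvable_subgroup H ->
  (forall x y, H x -> H y -> commute x y) \/
  exists K, [/\ is_subgroup K, K `<=` derived H, exists2 x, K x & x <> 1,
    (forall x y, K x -> K y -> commute x y)
  & forall x g, H g -> K x -> K (x ^ g)].
Proof.
move=> [sH exn]; have {}exn : exists n, `[< iter n (@derived gT) H = [set 1] >].
  by have [n] := exn; exists n; apply/asboolP.
case: (ex_minnP exn) => n /asboolP Hn nmin.
case: n Hn nmin => [H1 _|[H1 _|n Hn nmin]].
- by left=> x y; rewrite [H]H1 /= => -> ->.
- by left=> x y; exact: derived1_commute.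
right; exists (iter n.+1 (@derived gT) H); split.
- exact: iter_derived_subgroup.
- elim: {Hn nmin} n => // n IH; rewrite iterS; apply: subset_trans IH.
  by apply: derived_sub; exact: iter_derived_subgroup.
- apply: contrapT => h; have : (n.+2 <= n.+1)%N; last by rewrite ltnn.
  apply: nmin; apply/asboolP; apply/seteqP; split=> x /=.
    by move=> Kx; apply: contrapT => x1; apply: h; exists x.
  by move=> ->; case: (iter_derived_subgroup n.+1 sH).
- by move=> x y; exact: derived1_commute.
- by move=> x g Hg; exact: iter_derived_normal.
Qed.

End Subgroups.

(** * Lifting groups of formal diffeomorphisms *)

Section Realization.
Local Open Scope group_scope.
Variable R : realType.
Implicit Types (x y : formal_diffeo R) (g : germ_diffeo R) (Ghat : set (formal_diffeo R)).

Lemma taylor1 : taylor (1 : germ_diffeo R) = 1.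
Proof. by apply: (mulgI (taylor 1)); rewrite -taylor_morph !mulg1. Qed.

Lemma taylorV g : taylor g^-1 = (taylor g)^-1.
Proof. by apply: (mulgI (taylor g)); rewrite -taylor_morph !mulgV taylor1. Qed.

Lemma taylor_lift x : exists d : diffeo R, x = taylor (germ_of d).
Proof. by have [d] := taylor_surj x; exists d. Qed.

Lemma taylor_germ_of (d : diffeo R) : taylor (germ_of d) = taylor_coef d :> (nat -> R).
Proof. by apply/funext => n; exact: taylorE. Qed.

Lemma flat_eq_formal (f g f' g' : diffeo R) :
  taylor (germ_of f) * taylor (germ_of g) = taylor (germ_of f') * taylor (germ_of g') ->
  flat_eq (fun z : R => f (g z)) (fun z : R => f' (g' z)).
Proof.
have tM (a b : diffeo R) : taylor (germ_of a) * taylor (germ_of b) =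
    taylor (germ_of (diffeo_mul a b)).
  by rewrite -taylor_morph [germ_of a * _]germ_mulE.
rewrite !tM => E; split; try exact: (@dfun_smooth R (diffeo_mul _ _)).
have := congr1 (@fcoef R) E.
by rewrite !taylor_germ_of.
Qed.

(** A formal change of coordinate x is itself lifted to a germ u. Requiring g^u to lie in [G0]
    leaves exactly one lift of each series, since the expansion is injective on [G0]. *)
Lemma realize_conjugate Ghat (G0 : set (germ_diffeo R)) x : is_subgroup Ghat ->
  is_subgroup G0 -> (forall g, G0 g -> taylor g = 1 -> g = 1) ->
  (forall y, Ghat y -> exists2 g, G0 g & taylor g = y ^ x) ->
  exists G : set (germ_diffeo R),
    [/\ is_subgroup G, @taylor R @` G = Ghat & restricts_to_iso (@taylor R) G Ghat].
Proof.
move=> [H1 HM HV] [G1 GM GV] inj real; have [d xE] := taylor_lift x.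
pose u := germ_of d; pose G : set (germ_diffeo R) := [set g | Ghat (taylor g) /\ G0 (g ^ u)].
have sG : is_subgroup G.
  split=> [|a b [Ga Ka] [Gb Kb]|a [Ga Ka]]; split.
  - by rewrite taylor1.
  - by rewrite conj1g.
  - by rewrite taylor_morph; exact: HM.
  - by rewrite conjMg; exact: GM.
  - by rewrite taylorV; exact: HV.
  - by rewrite conjVg; exact: GV.
have surj y : Ghat y -> exists2 g, G g & taylor g = y.
  move=> Hy; have [g Gg gy] := real y Hy.
  have E : taylor (g ^ u^-1) = y.
    by rewrite conjgE !taylor_morph !taylorV invgK gy xE -/u conjgE !mulgA mulgV mul1g mulgK.
  by exists (g ^ u^-1) => //; split; [rewrite E|rewrite conjgKV].
exists G; split=> //.
  by apply/seteqP; split=> [_ [g [Gg _] <-]//|y /surj[g Gg <-]]; exists g.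
split; first by move=> a b _ _; exact: taylor_morph.
split.
- by move=> g [].
- move=> a b; rewrite !inE => -[Ga Ka] [Gb Kb] ab.
  have h : (a * b^-1) ^ u = 1.
    apply: inj; first by rewrite conjMg conjVg; apply: GM => //; exact: GV.
    by rewrite conjgE !taylor_morph !taylorV ab mulgV mul1g mulVg.
  apply: (mulIg b^-1); rewrite mulgV; apply: (conjg_inj u); by rewrite h conj1g.
- by move=> y /surj[g Gg <-]; exists g.
Qed.

Definition linear_formal (k : R) (k0 : k != 0%R) : formal_diffeo R.
Proof.
apply: (@FormalDiffeo R (fun i => k * fid R i)%R); first by rewrite mulr0.
by rewrite mulr1.
Defined.

(** For p = 1 and residue 0 every nonzero k is admissible, so the flow group contains all linear
    germs. *)
Lemma linear_realize Ghat x : is_subgroup Ghat ->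
  (forall y, Ghat y -> exists k (k0 : k != 0%R), y ^ x = linear_formal k0) ->
  exists G : set (germ_diffeo R),
    [/\ is_subgroup G, @taylor R @` G = Ghat & restricts_to_iso (@taylor R) G Ghat].
Proof.
move=> sG lin; have p1 : (0 < 1)%N by [].
apply: (realize_conjugate (x := x) sG (flow_group_subgroup p1 0%R)).
  by move=> g; exact: flow_group_inj.
move=> y /lin[k [k0 ->]]; have [d dE] := diffeo_linear k0.
exists (germ_of d).
  apply: (@flow_groupP _ _ _ k 0); last exact: flow_linear.
  by split; rewrite ?eqxx.
apply: formal_diffeoP => n; rewrite taylorE.
rewrite (_ : dfun d = fun z => k * z)%R; last by apply/funext.
by rewrite taylor_scale ?taylor_id//; exact: smooth_var.
Qed.

Lemma formal_mul_coef1 x y : (x * y) 1%N = (x 1%N * y 1%N)%R.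
Proof. by rewrite [LHS]fcomp1// fcoef0. Qed.

Lemma formal_inv_coef1 x : x^-1 1%N = (x 1%N)^-1%R.
Proof.
have := formal_mul_coef1 x^-1 x; rewrite mulVg => h.
by apply: (mulIf (fcoef1 x)); rewrite -h mulVf ?fcoef1.
Qed.

Lemma formal_conj_coef1 x y : (x ^ y) 1%N = x 1%N.
Proof.
rewrite conjgE !formal_mul_coef1 formal_inv_coef1 mulrCA mulVf ?mulr1//.
exact: fcoef1.
Qed.

(** The multiplier is a morphism to a commutative group, hence trivial on commutators. *)
Lemma derived_unipotent Ghat x : derived Ghat x -> x 1%N = 1%R.
Proof.
move=> dx; apply: (dx [set z : formal_diffeo R | z 1%N = 1%R]).
  split=> [|a b a1 b1|a a1]; first by [].
    by apply: etrans (formal_mul_coef1 a b) _; rewrite [a 1%N]a1 [b 1%N]b1 mulr1.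
  by apply: etrans (formal_inv_coef1 a) _; rewrite [a 1%N]a1 invr1.
move=> _ [a _ [b _ <-]]; rewrite commgEl.
apply: etrans (formal_mul_coef1 _ _) _.
by rewrite formal_conj_coef1 formal_inv_coef1 mulVf// fcoef1.
Qed.

(** Either some multiplier is neither 1 nor -1, and linearizing that element linearizes everything
    commuting with it; or all multipliers are 1 or -1, and without unipotent elements the group has
    at most two elements. *)
Lemma abelian_realize Ghat : is_subgroup Ghat ->
  (forall x y, Ghat x -> Ghat y -> commute x y) ->
  (forall x, Ghat x -> x 1%N = 1%R -> x = 1) ->
  exists G : set (germ_diffeo R),
    [/\ is_subgroup G, @taylor R @` G = Ghat & restricts_to_iso (@taylor R) G Ghat].
Proof.
move=> sG ab uni; have [H1 HM HV] := sG.
have [[h [Gh h2]]|small] := EM (exists h, Ghat h /\ (h 1%N ^+ 2 != 1)%R).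
  (* A real number with h_1^k = h_1, k > 1 and h_1 nonzero has absolute value 1, hence square 1:
     there is no resonance. *)
  have hk k : (1 < k)%N -> (h 1%N ^+ k != h 1%N)%R.
    case: k => // k k0; apply: contra h2 => /eqP hE.
    have /eqP : (h 1%N * (h 1%N ^+ k - 1) = 0)%R by rewrite mulrBr mulr1 -exprS hE subrr.
    rewrite mulf_eq0 (negbTE (fcoef1 h)) subr_eq0 => /eqP hk.
    have : (`|h 1%N| ^+ k == 1)%R by rewrite -normrX hk normr1.
    rewrite pexpr_eq1// => /eqP h1.
    by rewrite -real_normK ?num_real// h1 expr1n.
  have [f [f0 f1 hf]] := linearize (fcoef0 h) hk.
  have fn0 : (f 1%N != 0)%R by rewrite f1 oner_neq0.
  pose psi := FormalDiffeo f0 fn0; pose lin := linear_formal (fcoef1 h).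
  have E : h * psi = psi * lin by apply: formal_diffeoP => n; exact: hf.
  apply: (linear_realize (x := psi) sG) => y Gy.
  exists (y 1%N), (fcoef1 y); set z := y ^ psi.
  have hz : lin = h ^ psi by rewrite conjgE E mulKg.
  have zl : z * lin = lin * z by rewrite hz -!conjMg (ab _ _ Gy Gh).
  have z1 : z 1%N = y 1%N by exact: formal_conj_coef1.
  apply: formal_diffeoP => -[|[|n]] /=.
  - by rewrite mulr0; exact: (fcoef0 z).
  - by rewrite mulr1.
  rewrite mulr0.
  (* Commuting with the linear map of multiplier h_1 gives (h_1^m - h_1) z_m = 0 for m = n + 2. *)
  have := congr1 (fun u : formal_diffeo R => u n.+2) zl.
  rewrite [LHS]fcomp_scale [RHS]fcomp_sum ?fcoef0// => En.
  have Er : (\sum_(i < n.+3) lin i * (trunc n.+2 z ^+ i)`_n.+2 = h 1%N * z n.+2)%R.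
    rewrite big_ord_recl /= mulr0 mul0r add0r big_ord_recl /= mulr1 expr1 coef_trunc//.
    by rewrite big1 ?addr0// => i _; rewrite /fid /= mulr0 mul0r.
  move: En; rewrite Er => /eqP; rewrite -subr_eq0 -mulrBl mulf_eq0 subr_eq0.
  by rewrite (negbTE (hk n.+2 _))//= => /eqP.
have sq h : Ghat h -> (h 1%N ^+ 2 = 1)%R.
  by move=> Gh; apply/eqP; apply: contrapT => /negP h2; apply: small; exists h.
have [[h [Gh h1]]|triv] := EM (exists h, Ghat h /\ h <> 1); last first.
  apply: (linear_realize (x := 1) sG) => y Gy.
  exists 1%R, (oner_neq0 _).
  have -> : y = 1 by apply: contrapT => y1; apply: triv; exists y.
  by rewrite conj1g; apply: formal_diffeoP => n /=; rewrite mul1r.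
have sgn y : Ghat y -> y <> 1 -> y 1%N = (-1)%R.
  move=> Gy y1; have /eqP := sq _ Gy; rewrite sqrf_eq1 => /orP[/eqP /(uni _ Gy)//|/eqP//].
have hh : h * h = 1.
  by apply: uni; [exact: HM|rewrite formal_mul_coef1 (sgn _ Gh)// mulrNN mulr1].
have only y : Ghat y -> y <> 1 -> y = h.
  move=> Gy y1; have yh : y * h = 1.
    by apply: uni; [exact: HM|rewrite formal_mul_coef1 (sgn _ Gh)// (sgn _ Gy)// mulrNN mulr1].
  by apply: (mulIg h); rewrite yh hh.
(* The involution h is conjugate to -x by (x - h(x)) / 2. *)
pose phi_fun i : R := ((fid R i - h i) / 2)%R.
have phi0 : phi_fun 0%N = 0%R by rewrite /phi_fun fcoef0 subrr mul0r.
have phi1 : phi_fun 1%N = 1%R by rewrite /phi_fun (sgn _ Gh)// /fid /=; field.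
have phin0 : (phi_fun 1%N != 0)%R by rewrite phi1 oner_neq0.
pose phi := FormalDiffeo phi0 phin0.
have m1 : (-1 != 0 :> R)%R by rewrite oppr_eq0 oner_neq0.
have E : phi * h = linear_formal m1 * phi.
  apply: formal_diffeoP => n.
  have h0 : h 0%N = 0%R by exact: fcoef0.
  have hhn : fcomp h h n = fid R n by exact: (congr1 (fun u : formal_diffeo R => u n) hh).
  have L : fcomp phi_fun h n = ((h n - fid R n) / 2)%R.
    have := fcompBl (fid R) h n h0; rewrite fcomp1f// hhn => <-.
    rewrite !fcomp_sum// mulr_suml; apply: eq_bigr => i _.
    by rewrite /phi_fun mulrAC.
  have M : fcomp (fun i => -1 * fid R i)%R phi_fun n = (- phi_fun n)%R.
    rewrite -[in RHS](fcomp1f phi0) !fcomp_sum// -sumrN; apply: eq_bigr => i _.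
    by rewrite mulN1r mulNr.
  by rewrite [LHS]L [RHS]M /phi_fun; field.
apply: (linear_realize (x := phi^-1) sG) => y Gy.
have [->|/eqP y1] := eqVneq y 1.
  exists 1%R, (oner_neq0 _).
  by rewrite conj1g; apply: formal_diffeoP => n /=; rewrite mul1r.
exists (-1)%R, m1; rewrite (only _ Gy y1) conjgE invgK mulgA E mulgK//.
Qed.

Lemma unipotent_realize Ghat x : is_subgroup Ghat -> Ghat x -> x 1%N = 1%R -> x <> 1 ->
  (forall y, Ghat y -> commute (x ^ y) x) ->
  exists G : set (germ_diffeo R),
    [/\ is_subgroup G, @taylor R @` G = Ghat & restricts_to_iso (@taylor R) G Ghat].
Proof.
move=> sG Gx x1 xn1 xc; have [_ HM HV] := sG.
have [a aE] := taylor_lift x.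
have ax : fcoef x = taylor_coef a by rewrite aE taylor_germ_of.
have [|||p [p0 ta ap]] := @tangent_index R a.
- exact: dfun0.
- by rewrite -taylor_coef_idx1 -ax.
- by rewrite -ax => xf; apply: xn1; apply: formal_diffeoP => n; rewrite xf.
have [|||e he] := @conj_normal R (fcoef x) p p0.
- by [].
- by rewrite ax.
- by move=> i ip i1; rewrite ax ta// /fid (negbTE i1).
have pR : (p%:R != 0 :> R)%R by rewrite pnatr_eq0 -lt0n.
pose c := taylor_coef a p.+1; pose t := (p%:R * c)%R.
have t0 : (t != 0)%R by rewrite mulf_neq0.
(* With these t and lam, x agrees to order 2p + 1 with a conjugate of the flow
   of time t, which is enough to solve the conjugacy equation. *)
pose lam := ((t ^+ 2 / (2 * p%:R) + t ^+ 2 / (2 * p%:R ^+ 2) - e) * (p%:R / t))%R.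
have [d [df Jd dlt d2]] := nf_flow p0 lam t0.
have [||f [f0 f1 hf]] := he (taylor_coef d).
- by move=> i ip; rewrite dlt// ax -/c /t mulrAC mulfV ?mul1r.
- by rewrite d2 /lam; field; rewrite t0 pR.
have fn0 : (f 1%N != 0)%R by rewrite f1 oner_neq0.
pose psi := FormalDiffeo f0 fn0; pose del := taylor (germ_of d).
have E : x * psi = psi * del.
  by apply: formal_diffeoP => n; apply: etrans (hf n) _; rewrite /= -taylor_germ_of.
have dE : del = x ^ psi by rewrite conjgE E mulKg.
apply: (realize_conjugate (x := psi) sG (flow_group_subgroup p0 lam)).
  by move=> g; exact: flow_group_inj.
move=> y Gy; have [u uE] := taylor_lift (y ^ psi).
(* This conjugate is chosen so that b u = u d formally. It commutes with d by [xc] applied to the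
   inverse of y. *)
have [b bE] := taylor_lift ((x ^ y^-1) ^ psi).
have [g Gg gE] : exists2 g, flow_group p lam g & taylor g = taylor (germ_of u); last first.
  by exists g => //; rewrite gE.
have lep : (p.+1 <= p.*2)%N by rewrite -addnn -addn1 leq_add2l.
apply: (@flow_realize R p p0 lam d b u Jd).
- move=> i ip; rewrite dlt; last by apply: leq_trans lep; exact: leqW.
  by rewrite ltn_eqF// mul0r addr0.
- rewrite dlt// eqxx mul1r /fid eqSS (gtn_eqF p0) add0r.
  by rewrite /t mulrAC mulfV ?mul1r.
- rewrite -taylor_coef_idx1 -taylorE -bE.
  by rewrite !formal_conj_coef1.
- apply: flat_eq_formal; rewrite -bE -/del dE -!conjMg.
  by congr (_ ^ _); apply/esym; apply: xc; exact: HV.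
- apply: flat_eq_formal; rewrite -bE -uE -/del dE -!conjMg.
  by congr (_ ^ _); rewrite [x ^ y^-1]conjgE invgK -!mulgA mulVg mulg1.
Qed.

End Realization.

Theorem mainTheorem4 (R : realType) (Ghat : set (formal_diffeo R)) :
  solvable_subgroup Ghat ->
  exists G : set (germ_diffeo R),
    [/\ is_subgroup G,
        @taylor R @` G = Ghat
      & restricts_to_iso (@taylor R) G Ghat].
Proof.
move=> sol; have [sG _] := sol.
have [ab|[K [sK Kd [x Kx x1] Kab Kn]]] := solvable_abelian_normal sol.
  have [[x [Gx xu x1]]|uni] := EM (exists x, [/\ Ghat x, x 1%N = 1 & x <> 1%g]).
    apply: (unipotent_realize sG Gx xu x1) => y Gy.
    have -> : (x ^ y = x)%g by rewrite conjgE (ab _ _ Gx Gy) mulKg.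
    by [].
  apply: (abelian_realize sG ab) => x Gx xu.
  by apply: contrapT => x1; apply: uni; exists x.
have dK := Kd _ Kx.
apply: (unipotent_realize sG (derived_sub sG dK) (derived_unipotent dK) x1) => y Gy.
by apply: Kab => //; exact: Kn.
Qed.
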